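(* There is a recursively specified locally finite $1$-differential poset $P$ such that the formal power series $$Q_P(q):=\frac{M_{P,2}(q)}{F_P(q)^2}\in\mathbb{Z}[[q]]$$ is not rational over any field of characteristic zero. Consequently, Stanley's Problem 4 has a negative answer: it is not true that for every differential poset $P$ and every fixed positive integer $k$ one can write $M_{P,k}(q)=R(q)F_P(q)^k$ with $R(q)$ a rational function.
   Context: Let $P=\bigsqcup_{n\ge 0}P_n$ be a graded poset with rank function $\rho$ (so $P_n=\{x\in P:\rho(x)=n\}$, and $x\lessdot y$, read ''$y$ covers $x$'', implies $\rho(y)=\rho(x)+1$) and with least element $\widehat 0$. Elements covered by $x$ are its lower covers; elements covering $x$ are its upper covers. For a positive integer $r$, $P$ is $r$-differential if: (D1) $P$ is locally finite and graded, with least element $\widehat 0$; (D2) any two distinct elements have as many common upper covers as common lower covers; (D3) an element with $d$ lower covers has $d+r$ upper covers. A differential poset is a poset that is $r$-differential for some positive integer $r$. Each rank $P_n$ of such a poset is then finite; put $p_n=|P_n|$. The rank generating series is $F_P(q)=\sum_{n\ge 0}p_nq^n$. For a positive integer $k$, the weighted $k$-multichain series is $$M_{P,k}(q)=\sum_{\widehat 0\le x_1\le\cdots\le x_k}q^{\rho(x_1)+\cdots+\rho(x_k)},$$ the sum being over all $k$-tuples $(x_1,\dots,x_k)$ of elements of $P$ with $x_1\le\cdots\le x_k$. Both $M_{P,k}(q)$ and $F_P(q)^k$ have integer coefficients and constant term $1$, so the quotient $M_{P,2}(q)/F_P(q)^2$ is a well-defined element of $\mathbb{Z}[[q]]$.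 A series $S(q)\in\mathbb{Q}[[q]]$ is rational over a field $K$ of characteristic zero if, viewed in $K[[q]]$ via $\mathbb{Q}\subseteq K$, it is the power series expansion of a rational function in $K(q)$, i.e. there are $A,B\in K[q]$ with $B\ne 0$ and $B(q)S(q)=A(q)$. ''Recursively specified'' means that $P$ is given as the union of a compatible sequence of finite prefixes (the subposets of elements of rank at most $N$, $N=4,5,6,\dots$), each obtained from the previous one by an explicit recursive (computable) rule. *)

(* Defs.v *)
From mathcomp Require Import all_boot all_order all_algebra finmap.
From mathcomp Require Import boolp classical_sets functions cardinality.

Set Implicit Arguments.
Unset Strict Implicit.
Unset Printing Implicit Defensive.

Import Order.TTheory GRing.Theory.

Local Open Scope classical_set_scope.
Local Open Scope card_scope.
Local Open Scope ring_scope.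

Section Posets.
Context {d : Order.disp_t} {P : bPOrderType d}.
Implicit Types x y z : P.

Definition covers x y : Prop :=
  (x < y)%O /\ forall z, ~~ ((x < z)%O && (z < y)%O).

Definition lower_covers x : set P := [set z | covers z x].
Definition upper_covers x : set P := [set z | covers x z].

Definition locally_finite : Prop :=
  forall x y, finite_set [set z | (x <= z)%O && (z <= y)%O].

Definition graded (rho : P -> nat) : Prop :=
  rho \bot%O = 0%N /\ forall x y, covers x y -> rho y = (rho x).+1.

(* Cardinalities are compared by equinumerosity ([#=]), so that nothing is
   presupposed about the finiteness of the sets of covers. *)
Definition differential (r : nat) (rho : P -> nat) : Prop :=
  [/\ locally_finite,
      graded rho,
      forall x y, x <> y ->
        (upper_covers x `&` upper_covers y) #=
          (lower_covers x `&` lower_covers y)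
    & forall x n, lower_covers x #= `I_n -> upper_covers x #= `I_(n + r)].

End Posets.

(* A formal power series is its sequence of coefficients. *)
Definition fps (R : Type) := nat -> R.

Section PowerSeries.
Context {R : pzRingType}.
Implicit Types f g : fps R.

Definition fps_one : fps R := fun n => (n == 0)%:R.
Definition fps_mul f g : fps R := fun n => \sum_(i < n.+1) f i * g (n - i)%N.
Definition fps_exp f (k : nat) : fps R := iter k (fps_mul f) fps_one.

(* The inverse of a series with constant term 1, as the geometric series
   \sum_j (1 - f)^j; since 1 - f has no constant term, only the terms with
   j <= n contribute to the coefficient of q^n. *)
Definition fps_inv f : fps R :=
  fun n => \sum_(j < n.+1) fps_exp (fun i => fps_one i - f i) j n.

Definition fps_div f g : fps R := fps_mul f (fps_inv g).

End PowerSeries.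

Definition rational_series (K : fieldType) (S : fps K) : Prop :=
  exists A B : {poly K}, B != 0 /\
    forall n, fps_mul (fun i => B`_i) S n = A`_n.

Definition char_zero (K : fieldType) : Prop := [pchar K] =i pred0.

Definition rational_over (K : fieldType) (S : fps rat) : Prop :=
  rational_series (fun n => ratr (S n) : K).

Section Series.
Context {d : Order.disp_t} {P : bPOrderType d}.
Variable rho : P -> nat.

Definition rank_series : fps int :=
  fun n => (#|` fset_set [set x | rho x = n] |)%:Z.

(* The coefficient of q^n counts the tuples x_1 <= ... <= x_k of total rank n. *)
Definition multichain_series (k : nat) : fps int :=
  fun n => (#|` fset_set [set t : k.-tuple P |
    sorted <=%O t /\ (\sum_(x <- t) rho x)%N = n] |)%:Z.

Definition Q_series : fps int :=
  fps_div (multichain_series 2) (fps_exp rank_series 2).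

End Series.

(* Total recursive functions: the least class of functions nat^n -> nat that
   contains zero, successor and the projections and is closed under
   composition, primitive recursion and minimization of regular functions.
   Each function is specified pointwise, so the class is extensional. *)
Inductive recursive : forall n : nat, (n.-tuple nat -> nat) -> Prop :=
| rec_zero (h : 0.-tuple nat -> nat) :
    (forall t, h t = 0%N) -> recursive h
| rec_succ (h : 1.-tuple nat -> nat) :
    (forall t, h t = (thead t).+1) -> recursive h
| rec_proj n (i : 'I_n) (h : n.-tuple nat -> nat) :
    (forall t, h t = tnth t i) -> recursive h
| rec_comp n m (f : m.-tuple nat -> nat) (g : 'I_m -> n.-tuple nat -> nat)
    (h : n.-tuple nat -> nat) :
    recursive f -> (forall i, recursive (g i)) ->
    (forall t, h t = f [tuple g i t | i < m]) -> recursive h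
| rec_prim n (f : n.-tuple nat -> nat) (g : n.+2.-tuple nat -> nat)
    (h : n.+1.-tuple nat -> nat) :
    recursive f -> recursive g ->
    (forall t : n.-tuple nat, h [tuple of 0%N :: t] = f t) ->
    (forall a (t : n.-tuple nat),
       h [tuple of a.+1 :: t] = g [tuple of a :: h [tuple of a :: t] :: t]) ->
    recursive h
| rec_min n (f : n.+1.-tuple nat -> nat) (h : n.-tuple nat -> nat) :
    recursive f ->
    (forall t : n.-tuple nat, f [tuple of h t :: t] = 0%N) ->
    (forall (t : n.-tuple nat) a,
       (a < h t)%N -> f [tuple of a :: t] <> 0%N) ->
    recursive h.

Definition computable (f : nat -> nat) : Prop :=
  recursive (fun t : 1.-tuple nat => f (thead t)).

Section RecursiveSpecification.
Context {d : Order.disp_t} {P : bPOrderType d}.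
Variable rho : P -> nat.

(* Goedel number of the finite graded poset on the labels 0, ..., s - 1 which
   is the restriction of P to e 0, ..., e (s - 1): for each label, its rank
   followed by the increasing list of the labels below it. *)
Definition prefix_code (e : nat -> P) (s : nat) : nat :=
  CodeSeq.code
    [seq CodeSeq.code (rho (e x) :: [seq y <- iota 0 s | (e y <= e x)%O])
    | x <- iota 0 s].

(* The elements of P are labelled by the natural numbers so that, for each N,
   the elements of rank at most N are those with a label below s N.  Prefixes
   are thereby nested, and [step] computes each one from the previous one,
   starting from the finite poset of the elements of rank at most 4. *)
Definition recursively_specified : Prop :=
  exists (e : nat -> P) (s : nat -> nat) (step : nat -> nat),
    [/\ bijective e,
        forall N x, (rho (e x) <= N)%N = (x < s N)%N,
        computable step
      & forall N, (4 <= N)%N ->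
          prefix_code e (s N.+1) = step (prefix_code e (s N))].

End RecursiveSpecification.

(* Main.v *)
From HB Require Import structures.
Require Import Defs.
From mathcomp Require Import all_boot all_order all_algebra finmap.
From mathcomp Require Import boolp classical_sets functions cardinality.
From mathcomp Require Import zify.

(** The poset is built rank by rank. Given the ranks up to [N], the elements of
    rank [N.+1] may be described by the sets of elements of rank [N] that they
    cover, called blocks here. Conditions (D2) and (D3) at rank [N] say that two
    elements of rank [N] share as many blocks as lower covers, and that an
    element with [d] lower covers lies in [d.+1] blocks. Wagner's reflection
    construction always meets them: take the block [supers N w] of all upper
    covers of [w], for each [w] of rank [N.-1], and one singleton block for each
    element of rank [N]. There is some freedom. If [w] has exactly three upper
    covers [a], [b], [c], the four blocks [abc], [a], [b], [c] can be traded for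
    the three blocks [ab], [ac], [bc], because the number of blocks through each
    of [a], [b], [c] and through each pair of them is the same
    ([count_ssplit], [count_sblocks_mem], [count_sblocks_mem2]). The trade
    lowers the size of the new rank by one. From rank 4 on such a [w] always
    exists: an element with a single lower cover has two upper covers, hence its
    reflection has two lower covers and three upper covers
    ([sdeg1_exists], [sdeg2_exists], [triads_stage]).

    One binary choice per rank is enough to prescribe the parity of every
    coefficient of Q = M / F^2. The coefficient of index [n] depends on the
    ranks up to [n] only, and the size of rank [n] enters M once, through the
    pairs formed with the least element, but enters F^2 twice; changing that
    size by one therefore changes the parity of the coefficient. The choices are
    made so that M and T F^2 agree modulo 2, where T is the indicator series of
    the cubes, that is, so that the number [weight] of pairs counted by either
    series is even ([weight_even]). No choice is available below rank 5, but
    there T agrees with Q modulo 2, as Q starts with 1 - q. Cancelling F^2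
    modulo 2 gives Q = T modulo 2 ([Q_series_mod2]).

    A series of integers with these parities is rational over no field of
    characteristic zero ([cubes_mod2_irrational]). If B Q is a polynomial, the
    coefficients of B form a vector in the kernel of the matrix of entries
    Q_(m + i - j) for all large [m]. When [m] is a large cube, the gaps between
    cubes make this matrix congruent to the identity modulo 2, so its
    determinant is an odd integer, which is invertible in the field, and B = 0.
    The negative answer for two-element multichains follows, since M = R F^2
    forces R = Q.

    For the recursive specification, each prefix is stored as the list of its
    rows, a row being a rank followed by a down-set, which is the very list that
    is coded by [prefix_code]. The passage to the next prefix is a composition
    of ordinary list operations. A function is called [effective] when it is
    realised by a total recursive function on codes; closure properties for the
    list operations reduce [eff_next_stage] to the shape of the program. *)

Set Implicit Arguments.
Unset Strict Implicit.
Unset Printing Implicit Defensive.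

(** * Recursive functions of one, two and three variables *)

Definition computable2 (F : nat -> nat -> nat) : Prop :=
  recursive (fun t : 2.-tuple nat => F (tnth t ord0) (tnth t (lift ord0 ord0))).

Definition computable3 (F : nat -> nat -> nat -> nat) : Prop :=
  recursive (fun t : 3.-tuple nat =>
    F (tnth t ord0) (tnth t (lift ord0 ord0))
      (tnth t (lift ord0 (lift ord0 ord0)))).

Lemma rec_ext n (f g : n.-tuple nat -> nat) :
  f =1 g -> recursive f -> recursive g.
Proof. by move=> /funext ->. Qed.

Lemma recursive_proj n (i : 'I_n) : recursive (fun t => tnth t i).
Proof. exact: (@rec_proj n i). Qed.

Lemma recursive_comp1 n f (g : n.-tuple nat -> nat) :
  computable f -> recursive g -> recursive (fun t => f (g t)).
Proof.
move=> cf cg; apply: (rec_comp (g := fun=> g) cf) => // t /=.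
by rewrite /thead tnth_mktuple.
Qed.

Lemma recursive_comp2 n F (g h : n.-tuple nat -> nat) :
  computable2 F -> recursive g -> recursive h ->
  recursive (fun t => F (g t) (h t)).
Proof.
move=> cF cg ch.
apply: (rec_comp (g := fun i : 'I_2 => if i == ord0 then g else h) cF) => [i|t].
  by case: (i == ord0).
by rewrite !tnth_mktuple.
Qed.

Lemma computable_id : computable id.
Proof. exact: (recursive_proj ord0). Qed.

Lemma computable_succ : computable S.
Proof. by apply: rec_succ. Qed.

Lemma recursive_const n k : recursive (fun _ : n.-tuple nat => k).
Proof.
elim: k => [|k IHk]; last exact: (recursive_comp1 computable_succ).
have r0 : @recursive 0 (fun=> 0) by apply: rec_zero.
by apply: (rec_comp (g := fun (i : 'I_0) => fun=> 0) r0) => // -[].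
Qed.

Lemma computable_prim (z : nat -> nat) G (h : nat -> nat -> nat) :
  computable z -> computable3 G ->
  (forall a, h 0 a = z a) -> (forall n a, h n.+1 a = G n (h n a) a) ->
  computable2 h.
Proof.
move=> cz cG h0 hS; apply: (rec_prim cz cG) => [t|n t].
  by rewrite tnth0 tnthS h0.
by rewrite !tnth0 !tnthS tnth0 hS.
Qed.

Lemma computable_iter z G :
  computable z -> computable2 G ->
  computable2 (fun n a => iter n (G a) (z a)).
Proof.
move=> cz cG; apply: (computable_prim (G := fun _ y a => G a y) cz) => //.
by apply: (recursive_comp2 cG); apply: recursive_proj.
Qed.

Lemma computable_min F h :
  computable2 F -> (forall a, F (h a) a = 0) ->
  (forall a b, b < h a -> F b a <> 0) -> computable h.
Proof.
move=> cF Fh hmin; apply: (rec_min cF) => [t|t a]; rewrite tnth0 tnthS.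
  exact: Fh.
exact: hmin.
Qed.

Lemma computable_comp f g :
  computable f -> computable g -> computable (fun a => f (g a)).
Proof. exact: recursive_comp1. Qed.

Lemma computable_comp2 F g h :
  computable2 F -> computable g -> computable h ->
  computable (fun a => F (g a) (h a)).
Proof. exact: recursive_comp2. Qed.

Lemma computable_const k : computable (fun=> k).
Proof. exact: recursive_const. Qed.

Lemma computable_prim1 G k (h : nat -> nat) :
  computable2 G -> h 0 = k -> (forall n, h n.+1 = G n (h n)) -> computable h.
Proof.
move=> cG h0 hS.
have c2 : computable2 (fun n _ => h n).
  apply: (computable_prim (z := fun=> k) (G := fun n y _ => G n y)) => //.
    exact: computable_const.
  by apply: (recursive_comp2 cG); apply: recursive_proj.
exact: (computable_comp2 c2 computable_id (computable_const 0)).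
Qed.

Lemma computable2_add : computable2 addn.
Proof.
apply: (@rec_ext _ (fun t : 2.-tuple nat => iter (tnth t ord0) S
  (tnth t (lift ord0 ord0)))).
  by move=> t /=; rewrite iter_succn addnC.
apply: (@computable_iter id (fun _ => S)); first exact: computable_id.
by apply: (recursive_comp1 computable_succ); apply: recursive_proj.
Qed.

(** Booleans are read as the numbers 0 and 1 throughout. *)
Lemma computable_eqn0 : computable (fun n => n == 0).
Proof.
apply: (@computable_prim1 (fun _ _ => 0) 1) => //; exact: recursive_const.
Qed.

Lemma computable_odd : computable odd.
Proof.
apply: (@computable_prim1 (fun _ y => y == 0) 0) => //.
  by apply: (recursive_comp1 computable_eqn0); apply: recursive_proj.
by move=> n /=; case: odd.
Qed.

Lemma computable_half : computable half.
Proof.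
apply: (@computable_prim1 (fun n y => odd n + y) 0) => //.
  apply: (recursive_comp2 computable2_add); last exact: recursive_proj.
  by apply: (recursive_comp1 computable_odd); apply: recursive_proj.
by move=> n; rewrite -uphalfE uphalf_half.
Qed.

Lemma computable_double : computable double.
Proof.
apply: (@rec_ext _ (fun t : 1.-tuple nat => thead t + thead t)).
  by move=> t; rewrite addnn.
by apply: (recursive_comp2 computable2_add); apply: recursive_proj.
Qed.

(** The pairing out of which [CodeSeq.code] is built. *)
Definition paircode (a b : nat) : nat := 2 ^ a * b.*2.+1.

Definition pairfst (m : nat) : nat := logn 2 m.
Definition pairsnd (m : nat) : nat := iter (pairfst m).+1 half m.

Lemma iter_double n m : iter n double m = 2 ^ n * m.
Proof. by elim: n => [|n IHn]; rewrite ?mul1n //= IHn -mul2n mulnA expnS. Qed.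

Lemma iter_half_exp n m : iter n half (2 ^ n * m) = m.
Proof.
elim: n m => [|n IHn] m; first by rewrite mul1n.
by rewrite iterSr expnS -mulnA mul2n doubleK.
Qed.

Lemma paircode_gt0 a b : 0 < paircode a b.
Proof. by rewrite muln_gt0 expn_gt0. Qed.

Lemma pairfstK a b : pairfst (paircode a b) = a.
Proof.
rewrite /pairfst lognM ?expn_gt0 // pfactorK // lognE /= -[b.*2.+1]addn1.
by rewrite dvdn2 addn1 /= odd_double addn0.
Qed.

Lemma pairsndK a b : pairsnd (paircode a b) = b.
Proof.
by rewrite /pairsnd pairfstK iterS iter_half_exp -uphalfE uphalf_double.
Qed.

Lemma computable2_paircode : computable2 paircode.
Proof.
pose h n a := iter n double a.*2.+1.
apply: (@rec_ext _ (fun t : 2.-tuple nat =>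
    h (tnth t ord0) (tnth t (lift ord0 ord0)))).
  by move=> t; rewrite /h iter_double.
apply: (@computable_iter (fun a => a.*2.+1) (fun=> double)).
  exact: computable_comp computable_succ computable_double.
by apply: (recursive_comp1 computable_double); apply: recursive_proj.
Qed.

Lemma computable2_iterhalf : computable2 (fun n m => iter n half m).
Proof.
apply: (@computable_iter id (fun=> half)); first exact: computable_id.
by apply: (recursive_comp1 computable_half); apply: recursive_proj.
Qed.

(** The inverse projections of [paircode] divide by 2 as often as possible; for
    this every positive number has to be a pair. *)
Lemma paircode_surj m : 0 < m -> exists a b, m = paircode a b.
Proof.
elim/ltn_ind: m => m IHm m_gt0; have [om|/even_halfK em] := boolP (odd m).
  exists 0, m./2; rewrite /paircode mul1n -[LHS]odd_double_half om; lia.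
have [||a [b Em]] := IHm m./2; try lia.
exists a.+1, b; rewrite -em Em /paircode expnS -mul2n; lia.
Qed.

Lemma computable_pairfst : computable pairfst.
Proof.
(* The summand [m == 0] makes the search stop at once on 0, which codes no
   pair. *)
apply: (@computable_min (fun a m => odd (iter a half m + (m == 0)) == false)).
- apply: (@rec_ext _ (fun t : 2.-tuple nat =>
    (odd (iter (tnth t ord0) half (tnth t (lift ord0 ord0)) +
      (tnth t (lift ord0 ord0) == 0)) : nat) == 0 : nat)).
    by move=> t; case: odd.
  apply: (recursive_comp1 computable_eqn0); apply: (recursive_comp1 computable_odd).
  apply: (recursive_comp2 computable2_add).
    by apply: computable2_iterhalf.
  by apply: (recursive_comp1 computable_eqn0); apply: recursive_proj.
- case=> [|m] //; rewrite addn0.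
  have [//|a [b ->]] := @paircode_surj m.+1.
  by rewrite pairfstK iter_half_exp /= odd_double.
- case=> [|m] // c; rewrite addn0.
  have [//|a [b ->]] := @paircode_surj m.+1; rewrite pairfstK => ltca.
  have -> : paircode a b = 2 ^ c * (2 * (2 ^ (a - c.+1) * b.*2.+1)).
    rewrite /paircode !mulnA -expnSr -expnD; congr (2 ^ _ * _); lia.
  by rewrite iter_half_exp oddM.
Qed.

Lemma computable_pairsnd : computable pairsnd.
Proof.
apply: (computable_comp2 computable2_iterhalf _ computable_id).
exact: computable_comp computable_succ computable_pairfst.
Qed.

(** * Effective functions between coded types *)

(** The codes of a type need not exhaust the natural numbers: nothing is asked
    of the functions that realise [f] below outside of the codes. *)
Class encodable (T : Type) := enc : T -> nat.
#[global] Hint Mode encodable ! : typeclass_instances.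

#[global] Instance enc_nat : encodable nat := id.
#[global] Instance enc_bool : encodable bool := nat_of_bool.
#[global] Instance enc_pair A B `{encodable A} `{encodable B} :
  encodable (A * B) := fun p => paircode (enc p.1) (enc p.2).
(** On lists of numbers this is [CodeSeq.code], and the code of [x :: s] is that
    of the pair [(x, s)]. *)
#[global] Instance enc_seq A `{encodable A} : encodable (seq A) :=
  foldr (fun x m => paircode (enc x) m) 0.

(** Parameters of a function of several variables are gathered in a tuple [A]
    of the variables in scope; [f : A -> B] is then an expression in these
    variables. *)
Definition effective {A B} `{encodable A} `{encodable B} (f : A -> B) : Prop :=
  exists g, computable g /\ forall a, g (enc a) = enc (f a).

Lemma eff_nat (f : nat -> nat) : effective f -> computable f.
Proof. by move=> [g [cg gE]]; apply: rec_ext cg => t; apply: gE. Qed.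

Lemma eff_ext A `{encodable A} B `{encodable B}
    (f g : A -> B) : f =1 g -> effective f -> effective g.
Proof. by move=> /funext ->. Qed.

Lemma eff_id A `{encodable A} : effective (fun a : A => a).
Proof. by exists id; split=> //; apply: computable_id. Qed.

Lemma eff_const A `{encodable A} B `{encodable B}
    (b : B) : effective (fun _ : A => b).
Proof. by exists (fun=> enc b); split=> //; apply: computable_const. Qed.

Lemma eff_comp A `{encodable A} B `{encodable B} C `{encodable C}
    (f : B -> C) (g : A -> B) :
  effective f -> effective g -> effective (fun a => f (g a)).
Proof.
move=> [f' [cf fE]] [g' [cg gE]]; exists (fun a => f' (g' a)).
by split=> [|a]; [apply: computable_comp | rewrite gE fE].
Qed.

Lemma eff_pair A `{encodable A} B `{encodable B} C `{encodable C}
    (f : A -> B) (g : A -> C) :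
  effective f -> effective g -> effective (fun a => (f a, g a)).
Proof.
move=> [f' [cf fE]] [g' [cg gE]]; exists (fun a => paircode (f' a) (g' a)).
split=> [|a]; first exact: computable_comp2 computable2_paircode cf cg.
by rewrite gE fE.
Qed.

Lemma eff_fst A `{encodable A} B `{encodable B} C `{encodable C}
    (f : A -> B * C) : effective f -> effective (fun a => (f a).1).
Proof.
move=> [f' [cf fE]]; exists (fun a => pairfst (f' a)).
split=> [|a]; first exact: computable_comp computable_pairfst cf.
by rewrite fE pairfstK.
Qed.

Lemma eff_snd A `{encodable A} B `{encodable B} C `{encodable C}
    (f : A -> B * C) : effective f -> effective (fun a => (f a).2).
Proof.
move=> [f' [cf fE]]; exists (fun a => pairsnd (f' a)).
split=> [|a]; first exact: computable_comp computable_pairsnd cf.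
by rewrite fE pairsndK.
Qed.

Lemma eff_of2 A `{encodable A} (F : nat -> nat -> nat) (f g : A -> nat) :
  computable2 F -> effective f -> effective g -> effective (fun a => F (f a) (g a)).
Proof.
move=> cF [f' [cf fE]] [g' [cg gE]]; exists (fun a => F (f' a) (g' a)).
by split=> [|a]; [apply: computable_comp2 | rewrite fE gE].
Qed.

Lemma eff_of1 A `{encodable A} (F : nat -> nat) (f : A -> nat) :
  computable F -> effective f -> effective (fun a => F (f a)).
Proof.
move=> cF [f' [cf fE]]; exists (fun a => F (f' a)).
by split=> [|a]; [apply: computable_comp | rewrite fE].
Qed.

(** As the identity of [nat] realises it, coding itself is effective. *)
Lemma eff_enc A `{encodable A} B `{encodable B}
    (f : A -> B) : effective f -> effective (fun a => enc (f a)).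
Proof. by []. Qed.

Lemma eff_bool A `{encodable A}
    (f : A -> bool) : effective (fun a => f a : nat) -> effective f.
Proof. by []. Qed.

Lemma eff_nat_of_bool A `{encodable A}
    (f : A -> bool) : effective f -> effective (fun a => f a : nat).
Proof. by []. Qed.

Lemma eff_iter A `{encodable A} B `{encodable B}
    (n : A -> nat) (f : A -> B -> B) (z : A -> B) :
  effective n -> effective (fun p : A * B => f p.1 p.2) -> effective z ->
  effective (fun a => iter (n a) (f a) (z a)).
Proof.
move=> [n' [cn nE]] [f' [cf fE]] [z' [cz zE]].
exists (fun a => iter (n' a) (fun b => f' (paircode a b)) (z' a)); split.
  have c2 := @computable_iter z' (fun a b => f' (paircode a b)) cz _.
  apply: (computable_comp2 (c2 _) cn computable_id).
  by apply: (recursive_comp1 cf); apply: computable2_paircode.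
move=> a; rewrite nE zE.
by change (enc (n a)) with (n a); elim: (n a) => //= k IHk; rewrite IHk -(fE (a, _)).
Qed.

(** A conditional is a loop that runs once or not at all. *)
Lemma eff_if A `{encodable A} B `{encodable B} (c : A -> bool) (f g : A -> B) :
  effective c -> effective f -> effective g ->
  effective (fun a => if c a then f a else g a).
Proof.
move=> /eff_nat_of_bool cc cf cg.
apply: (eff_ext (f := fun a => iter (c a) (fun=> f a) (g a))) => [a|].
  by case: (c a).
by apply: eff_iter cc _ cg; apply: eff_comp cf (eff_fst eff_id).
Qed.

(** Lists: since [x :: s] and [(x, s)] have the same code, a case analysis
    only tests whether a code vanishes. *)
Lemma eff_match A `{encodable A} B `{encodable B} C `{encodable C}
    (l : A -> seq B) (d : A -> C) (f : A -> B -> seq B -> C) :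
  effective l -> effective d ->
  effective (fun p : A * (B * seq B) => f p.1 p.2.1 p.2.2) ->
  effective (fun a => if l a is x :: s then f a x s else d a).
Proof.
move=> [l' [cl lE]] [d' [cd dE]] [f' [cf fE]].
have c0 : effective (fun a : nat => l' a == 0).
  exists (fun a => l' a == 0).
  by split=> //; apply: computable_comp computable_eqn0 cl.
have cf' : effective (fun a => f' (paircode a (l' a))).
  exists (fun a => f' (paircode a (l' a))); split=> //.
  apply: computable_comp cf _.
  exact: computable_comp2 computable2_paircode computable_id cl.
have cd' : effective d' by exists d'.
exists (fun a => if l' a == 0 then d' a else f' (paircode a (l' a))); split.
  exact: eff_nat (eff_if c0 cd' cf').
move=> a; rewrite lE; case: (l a) => [|x s]; first exact: dE.
by rewrite eqn0Ngt paircode_gt0 -(fE (a, (x, s))).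
Qed.

Lemma eff_cons A `{encodable A} B `{encodable B} (f : A -> B) (g : A -> seq B) :
  effective f -> effective g -> effective (fun a => f a :: g a).
Proof.
move=> [f' [cf fE]] [g' [cg gE]]; exists (fun a => paircode (f' a) (g' a)).
split=> [|a]; first exact: computable_comp2 computable2_paircode cf cg.
by rewrite gE fE.
Qed.

Lemma size_le_enc B `{encodable B} (l : seq B) : size l <= enc l.
Proof.
elim: l => //= x l IHl; change (size l < paircode (enc x) (enc l)).
have: 0 < 2 ^ enc x by rewrite expn_gt0.
by rewrite /paircode; nia.
Qed.

(** The loop that consumes a list is run as many times as its code, which bounds
    its length; further rounds do nothing on the empty list. *)
Lemma eff_foldl A `{encodable A} B `{encodable B} C `{encodable C}
    (f : A -> C -> B -> C) (z : A -> C) (l : A -> seq B) :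
  effective (fun p : A * (C * B) => f p.1 p.2.1 p.2.2) -> effective z -> effective l ->
  effective (fun a => foldl (f a) (z a) (l a)).
Proof.
move=> cf cz cl.
pose step a (p : C * seq B) :=
  if p.2 is x :: s then (f a p.1 x, s) else p.
apply: (eff_ext (f := fun a => (iter (enc (l a)) (step a) (z a, l a)).1)) => [a|].
  suff E n s : size s <= n -> forall c,
      (iter n (step a) (c, s)).1 = foldl (f a) c s by rewrite E ?size_le_enc.
  elim: n s => [|n IHn] [|x s] // le_s_n c; last by rewrite iterSr IHn.
  by rewrite iterSr IHn.
apply: eff_fst; apply: eff_iter; first exact: eff_enc.
  apply: (@eff_match _ _ _ _ _ _ (fun p : A * (C * seq B) => p.2.2)
    (fun p => p.2) (fun p x s => (f p.1 p.2.1 x, s))).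
  - by do 2! apply: eff_snd; apply: eff_id.
  - by apply: eff_snd; apply: eff_id.
  - apply: eff_pair; last by do 2! apply: eff_snd; apply: eff_id.
    apply: (@eff_comp _ _ _ _ _ _ _ (fun q : A * (C * seq B) * (B * seq B) =>
       (q.1.1, (q.1.2.1, q.2.1))) cf).
    apply: eff_pair; first by do 2! apply: eff_fst; apply: eff_id.
    apply: eff_pair.
      by apply: eff_fst; apply: eff_snd; apply: eff_fst; apply: eff_id.
    by apply: eff_fst; apply: eff_snd; apply: eff_id.
exact: eff_pair.
Qed.

Lemma eff_rev A `{encodable A} B `{encodable B} (l : A -> seq B) :
  effective l -> effective (fun a => rev (l a)).
Proof.
move=> cl; apply: (eff_ext (f := fun a => foldl (fun s x => x :: s) [::] (l a))).
  by move=> a; elim/last_ind: (l a) => // s x; rewrite foldl_rcons rev_rcons => ->.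
apply: (eff_foldl (f := fun _ s x => x :: s) _ (eff_const [::]) cl).
by apply: eff_cons; [do 2! apply: eff_snd | apply: eff_fst; apply: eff_snd];
  apply: eff_id.
Qed.

Lemma eff_foldr A `{encodable A} B `{encodable B} C `{encodable C}
    (f : A -> B -> C -> C) (z : A -> C) (l : A -> seq B) :
  effective (fun p : A * (B * C) => f p.1 p.2.1 p.2.2) -> effective z -> effective l ->
  effective (fun a => foldr (f a) (z a) (l a)).
Proof.
move=> cf cz cl.
apply: (eff_ext (f := fun a => foldl (fun c b => f a b c) (z a) (rev (l a)))).
  by move=> a; rewrite foldl_rev.
apply: eff_foldl cz (eff_rev cl).
apply: (@eff_comp _ _ _ _ _ _ _ (fun q : A * (C * B) =>
   (q.1, (q.2.2, q.2.1))) cf).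
apply: eff_pair; first by apply: eff_fst; apply: eff_id.
by apply: eff_pair; [apply: eff_snd | apply: eff_fst];
   apply: eff_snd; apply: eff_id.
Qed.

Lemma eff_fst1 A `{encodable A} B `{encodable B} : effective (@fst A B).
Proof. by apply: eff_fst; apply: eff_id. Qed.

Lemma eff_snd1 A `{encodable A} B `{encodable B} : effective (@snd A B).
Proof. by apply: eff_snd; apply: eff_id. Qed.

(** Reduces a goal to the computability of the variables, which are
    projections of the tuple of all variables in scope. *)
Ltac eff_var := solve [repeat lazymatch goal with
  | |- effective (fun a => a) => exact: eff_id
  | |- effective fst => exact: eff_fst1
  | |- effective snd => exact: eff_snd1
  | |- effective (fun a => _.1) => apply: eff_fst
  | |- effective (fun a => _.2) => apply: eff_snd
  end].

Lemma eff_map A `{encodable A} B `{encodable B} C `{encodable C}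
    (f : A -> B -> C) (l : A -> seq B) :
  effective (fun p : A * B => f p.1 p.2) -> effective l ->
  effective (fun a => [seq f a x | x <- l a]).
Proof.
move=> cf cl.
apply: (eff_foldr (f := fun a x s => f a x :: s) _ (eff_const [::]) cl).
apply: eff_cons; last eff_var.
apply: (@eff_comp _ _ _ _ _ _ _ (fun q : A * (B * seq C) =>
   (q.1, q.2.1)) cf).
apply: eff_pair; eff_var.
Qed.

Lemma eff_filter A `{encodable A} B `{encodable B}
    (f : A -> B -> bool) (l : A -> seq B) :
  effective (fun p : A * B => f p.1 p.2) -> effective l ->
  effective (fun a => [seq x <- l a | f a x]).
Proof.
move=> cf cl.
apply: (eff_foldr (f := fun a x s => if f a x then x :: s else s) _
  (eff_const [::]) cl).
apply: eff_if; [|apply: eff_cons; eff_var|eff_var].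
apply: (@eff_comp _ _ _ _ _ _ _ (fun q : A * (B * seq B) =>
   (q.1, q.2.1)) cf).
apply: eff_pair; eff_var.
Qed.

Lemma eff_has A `{encodable A} B `{encodable B}
    (f : A -> B -> bool) (l : A -> seq B) :
  effective (fun p : A * B => f p.1 p.2) -> effective l ->
  effective (fun a => has (f a) (l a)).
Proof.
move=> cf cl.
apply: (eff_foldr (f := fun a x b => if f a x then true else b) _
  (eff_const false) cl).
apply: eff_if; [|exact: eff_const|eff_var].
apply: (@eff_comp _ _ _ _ _ _ _ (fun q : A * (B * bool) =>
   (q.1, q.2.1)) cf).
apply: eff_pair; eff_var.
Qed.

Lemma eff_cat A `{encodable A} B `{encodable B} (l s : A -> seq B) :
  effective l -> effective s -> effective (fun a => l a ++ s a).
Proof.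
move=> cl cs.
apply: (eff_ext (f := fun a => foldr cons (s a) (l a))) => [a|].
  by elim: (l a) => //= x u ->.
apply: (eff_foldr (f := fun _ => cons) _ cs cl); apply: eff_cons; eff_var.
Qed.

Lemma eff_head A `{encodable A} B `{encodable B} b (l : A -> seq B) :
  effective l -> effective (fun a => head b (l a)).
Proof.
move=> cl; apply: (eff_match (f := fun _ x _ => x) cl (eff_const b)).
eff_var.
Qed.

Lemma eff_behead A `{encodable A} B `{encodable B} (l : A -> seq B) :
  effective l -> effective (fun a => behead (l a)).
Proof.
move=> cl; apply: (eff_match (f := fun _ _ s => s) cl (eff_const [::])).
eff_var.
Qed.

Lemma eff_nth A `{encodable A} B `{encodable B} b (l : A -> seq B) (i : A -> nat) :
  effective l -> effective i -> effective (fun a => nth b (l a) (i a)).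
Proof.
move=> cl ci.
apply: (eff_ext (f := fun a => head b (iter (i a) behead (l a)))) => [a|].
  elim: (i a) (l a) => [|n IHn] [|x s] //; last by rewrite iterSr IHn.
  by rewrite iterSr IHn /= !nth_nil.
apply: eff_head; apply: (eff_iter (f := fun _ => behead) ci _ cl).
apply: eff_behead; eff_var.
Qed.

Lemma eff_succ A `{encodable A} (f : A -> nat) :
  effective f -> effective (fun a => (f a).+1).
Proof. exact: eff_of1 computable_succ. Qed.

Lemma eff_size A `{encodable A} B `{encodable B} (l : A -> seq B) :
  effective l -> effective (fun a => size (l a)).
Proof.
move=> cl; apply: (eff_foldr (f := fun _ _ n => n.+1) _ (eff_const 0) cl).
apply: eff_succ; eff_var.
Qed.

Lemma eff_iota A `{encodable A} (n : A -> nat) :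
  effective n -> effective (fun a => iota 0 (n a)).
Proof.
move=> cn.
apply: (eff_ext (f := fun a => rev (iter (n a) (fun s => size s :: s) [::]))).
  move=> a; elim: (n a) => // k IHk.
  by rewrite iterS rev_cons IHk -(size_rev (iter _ _ _)) IHk size_iota -addn1 iotaD cats1.
apply: eff_rev; apply: (eff_iter (f := fun _ s => size s :: s) cn).
  by apply: eff_cons; [apply: eff_size|]; eff_var.
exact: eff_const.
Qed.

Lemma eff_add A `{encodable A} (f g : A -> nat) :
  effective f -> effective g -> effective (fun a => f a + g a).
Proof. exact: eff_of2 computable2_add. Qed.

Lemma eff_sumn A `{encodable A} (l : A -> seq nat) :
  effective l -> effective (fun a => sumn (l a)).
Proof.
move=> cl; apply: (eff_foldr (f := fun _ => addn) _ (eff_const 0) cl).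
apply: eff_add; eff_var.
Qed.

Lemma eff_odd A `{encodable A} (f : A -> nat) :
  effective f -> effective (fun a => odd (f a)).
Proof. by move=> cf; apply: eff_bool; apply: eff_of1 computable_odd cf. Qed.

Lemma eff_eq0 A `{encodable A} (f : A -> nat) :
  effective f -> effective (fun a => f a == 0).
Proof. by move=> cf; apply: eff_bool; apply: eff_of1 computable_eqn0 cf. Qed.

Lemma eff_mul A `{encodable A} (f g : A -> nat) :
  effective f -> effective g -> effective (fun a => f a * g a).
Proof.
move=> cf cg.
apply: (eff_ext (f := fun a => iter (f a) (addn (g a)) 0)) => [a|].
  by rewrite iter_addn_0 mulnC.
apply: eff_iter cf _ (eff_const 0).
by apply: eff_add; [apply: eff_comp cg _|]; eff_var.
Qed.

Lemma eff_pred A `{encodable A} (f : A -> nat) :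
  effective f -> effective (fun a => (f a).-1).
Proof.
apply: eff_of1; apply: (@computable_prim1 (fun n _ => n) 0) => //.
exact: recursive_proj.
Qed.

Lemma eff_sub A `{encodable A} (f g : A -> nat) :
  effective f -> effective g -> effective (fun a => f a - g a).
Proof.
move=> cf cg.
apply: (eff_ext (f := fun a => iter (g a) predn (f a))) => [a|].
  by rewrite iter_predn.
apply: (eff_iter (f := fun _ => predn) cg _ cf); apply: eff_pred; eff_var.
Qed.

Lemma eff_leq A `{encodable A} (f g : A -> nat) :
  effective f -> effective g -> effective (fun a => f a <= g a).
Proof. by move=> cf cg; apply: eff_eq0; apply: eff_sub. Qed.

Lemma eff_and A `{encodable A} (f g : A -> bool) :
  effective f -> effective g -> effective (fun a => f a && g a).
Proof. by move=> cf cg; apply: eff_if cf cg (eff_const false). Qed.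

Lemma eff_neg A `{encodable A} (f : A -> bool) :
  effective f -> effective (fun a => ~~ f a).
Proof. by move=> cf; apply: eff_if cf (eff_const false) (eff_const true). Qed.

Lemma eff_eqn A `{encodable A} (f g : A -> nat) :
  effective f -> effective g -> effective (fun a => f a == g a).
Proof.
move=> cf cg; apply: (eff_ext (f := fun a => (f a <= g a) && (g a <= f a))).
  by move=> a; rewrite eqn_leq.
by apply: eff_and; apply: eff_leq.
Qed.

Lemma eff_mem A `{encodable A} (f : A -> nat) (l : A -> seq nat) :
  effective f -> effective l -> effective (fun a => f a \in l a).
Proof.
move=> cf cl; apply: (eff_ext (f := fun a => has (fun x => f a == x) (l a))).
  by move=> a; apply/hasP/idP => [[x xl /eqP->]|fa] //; exists (f a).
by apply: eff_has cl; apply: eff_eqn; [apply: eff_comp cf _|]; eff_var.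
Qed.

(** The head symbol of the body decides which closure property applies. *)
Ltac eff_step := lazymatch goal with
  | |- effective (fun a => if _ then _ else _) => apply: eff_if
  | |- effective (fun a => _ :: _) => apply: eff_cons
  | |- effective (fun a => _ ++ _) => apply: eff_cat
  | |- effective (fun a => map _ _) => apply: eff_map
  | |- effective (fun a => filter _ _) => apply: eff_filter
  | |- effective (fun a => has _ _) => apply: eff_has
  | |- effective (fun a => head _ _) => apply: eff_head
  | |- effective (fun a => behead _) => apply: eff_behead
  | |- effective (fun a => nth _ _ _) => apply: eff_nth
  | |- effective (fun a => size _) => apply: eff_size
  | |- effective size => apply: (eff_size eff_id)
  | |- effective (fun a => iota 0 _) => apply: eff_iota
  | |- effective (fun a => sumn _) => apply: eff_sumn
  | |- effective (fun a => odd _) => apply: eff_odd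
  | |- effective (fun a => _ == _) => apply: eff_eqn
  | |- effective (fun a => _ <= _) => apply: eff_leq
  | |- effective (fun a => _ && _) => apply: eff_and
  | |- effective (fun a => ~~ _) => apply: eff_neg
  | |- effective (fun a => _ \in _) => apply: eff_mem
  | |- effective (fun a => nat_of_bool _) => apply: eff_nat_of_bool
  | |- effective (fun a => _ + _) => apply: eff_add
  | |- effective (fun a => _ - _) => apply: eff_sub
  | |- effective (fun a => _ * _) => apply: eff_mul
  | |- effective (fun a => _.-1) => apply: eff_pred
  | |- effective (fun a => _.+1) => apply: eff_succ
  | |- effective (fun a => ?k) => exact: eff_const
  end.

Ltac eff_tac := repeat first [eff_var | eff_step].

(** * Growing a finite prefix by one rank *)

(** A prefix with [s] elements is the list of the rows of the labels
    [0, ..., s - 1]: the rank of the label, then the increasing list of the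
    labels below it. *)
Definition row_rank (L : seq (seq nat)) x := head 0 (nth [::] L x).

Definition row_le (L : seq (seq nat)) (y x : nat) := y \in behead (nth [::] L x).

Definition top_rank L := row_rank L (size L).-1.

Definition level L n := [seq x : nat <- iota 0 (size L) | row_rank L x == n].

Definition top_level L := level L (top_rank L).

Definition sub_level L :=
  [seq x : nat <- iota 0 (size L) | (row_rank L x).+1 == top_rank L].

Definition uppers L w := [seq y : nat <- top_level L | row_le L w y].

Definition wagner_blocks L : seq (seq nat) :=
  [seq uppers L w | w <- sub_level L] ++ [seq [:: y] | y <- top_level L].

Definition pairs (u : seq nat) : seq (seq nat) :=
  [:: [:: nth 0 u 0; nth 0 u 1]; [:: nth 0 u 0; nth 0 u 2];
      [:: nth 0 u 1; nth 0 u 2]].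

Definition split_blocks L z : seq (seq nat) :=
  pairs (uppers L z) ++
  [seq uppers L w | w : nat <- sub_level L & w != z] ++
  [seq [:: y] | y : nat <- top_level L & y \notin uppers L z].

Definition triads L := [seq w : nat <- sub_level L | size (uppers L w) == 3].

Definition is_cube n := has (fun k : nat => k * k * k == n) (iota 0 n.+1).

(** Counts the pairs that contribute to the coefficient of index [n] of M, and
    those that contribute to that of T F^2. Both are counted over the labels of
    [L] alone. *)
Definition weight L n : nat :=
  sumn [seq sumn [seq (row_le L x y && (row_rank L x + row_rank L y == n) : nat) +
    ((row_rank L x + row_rank L y <= n) &&
        is_cube (n - (row_rank L x + row_rank L y)) : nat)
   | y <- iota 0 (size L)] | x <- iota 0 (size L)].

(** With Wagner's blocks the weight of the next prefix would have this parity,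
    as each element of the new rank takes part in three of the pairs. *)
Definition needs_split L :=
  odd (weight L (top_rank L).+1 + size (wagner_blocks L)) && (0 < size (triads L)).

Definition new_blocks L :=
  if needs_split L then split_blocks L (head 0 (triads L)) else wagner_blocks L.

Definition new_row L x (B : seq nat) : seq nat :=
  (top_rank L).+1 :: [seq y : nat <- iota 0 (size L) | has (row_le L y) B] ++ [:: x].

Definition extend L (Bs : seq (seq nat)) : seq (seq nat) :=
  L ++ [seq new_row L (size L + j) (nth [::] Bs j) | j <- iota 0 (size Bs)].

Definition next_stage L := extend L (new_blocks L).

Fixpoint stage N := if N is N'.+1 then next_stage (stage N') else [:: [:: 0; 0]].

Lemma eff_next_stage : effective next_stage.
Proof.
rewrite /next_stage /extend /new_row /new_blocks /needs_split /weight /is_cube /triads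
  /split_blocks /pairs /wagner_blocks /uppers /sub_level /top_level /level
  /top_rank /row_le /row_rank.
eff_tac.
Qed.

(** * Ranks and labels of the limit poset *)

Section Labels.

Implicit Types (N n x y z w u : nat).

(** The label [x] occurs in [stage x], and its row is the same in all later
    stages, so the limit order and rank can be read off there. *)
Definition srank x := row_rank (stage x) x.
Definition sle y x := row_le (stage x) y x.
Definition ssize N := size (stage N).
Definition slevel N := [seq x <- iota 0 (ssize N) | srank x == N].
(** The rank below [N]; there is none when [N] is 0. *)
Definition slower N := [seq x <- iota 0 (ssize N) | (srank x).+1 == N].
Definition sblocks N := new_blocks (stage N).
Definition supers N w := [seq y <- slevel N | sle w y].
(** The block that gave rise to the label [x]. *)
Definition sblock x := nth [::] (sblocks (srank x).-1) (x - ssize (srank x).-1).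

Lemma new_blocks_gt0 L : 0 < size L -> 0 < size (new_blocks L).
Proof.
move=> L_gt0; rewrite /new_blocks; case: ifP => // _.
rewrite size_cat !size_map.
suff : (size L).-1 \in top_level L by case: (top_level L) => //= *; lia.
by rewrite mem_filter eqxx mem_iota /=; lia.
Qed.

Lemma size_next_stage L : size (next_stage L) = size L + size (new_blocks L).
Proof. by rewrite size_cat size_map size_iota. Qed.

Lemma ssizeS N : ssize N.+1 = ssize N + size (sblocks N).
Proof. exact: size_next_stage. Qed.

Lemma ssize_gt N : N < ssize N.
Proof.
elim: N => // N IHN; rewrite ssizeS.
have := @new_blocks_gt0 (stage N) (leq_ltn_trans (leq0n N) IHN).
by rewrite /sblocks; lia.
Qed.

Lemma sblocks_gt0 N : 0 < size (sblocks N).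
Proof. exact/new_blocks_gt0/(leq_ltn_trans _ (ssize_gt N)). Qed.

Lemma leq_ssize N M : N <= M -> ssize N <= ssize M.
Proof.
move/subnK <-; elim: (M - N) => // k IHk; rewrite addSn ssizeS; lia.
Qed.

Lemma nth_stage N M x : x < ssize N -> N <= M ->
  nth [::] (stage M) x = nth [::] (stage N) x.
Proof.
move=> ltx /subnK <-; elim: (M - N) => // k IHk.
rewrite addSn /= {1}/next_stage nth_cat -/(ssize _).
by rewrite (leq_trans ltx (leq_ssize (leq_addl _ _))) IHk.
Qed.

Lemma nth_stage_self N x : x < ssize N ->
  nth [::] (stage N) x = nth [::] (stage x) x.
Proof.
move=> ltx; have [leNx|/ltnW lexN] := leqP N x.
  by rewrite -(nth_stage ltx leNx).
by rewrite (nth_stage (ssize_gt x) lexN).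
Qed.

Lemma row_rank_stage N x : x < ssize N -> row_rank (stage N) x = srank x.
Proof. by move=> ltx; rewrite /srank /row_rank nth_stage_self. Qed.

Lemma row_le_stage N x y : x < ssize N -> row_le (stage N) y x = sle y x.
Proof. by move=> ltx; rewrite /sle /row_le nth_stage_self. Qed.

Lemma nth_new N x : ssize N <= x < ssize N.+1 ->
  nth [::] (stage x) x =
    new_row (stage N) x (nth [::] (sblocks N) (x - ssize N)).
Proof.
move=> /andP[leNx ltx]; rewrite -(nth_stage_self ltx) /= {1}/next_stage nth_cat.
rewrite -/(ssize _) ltnNge leNx /=.
have ltj : x - ssize N < size (new_blocks (stage N)).
  by move: ltx; rewrite ssizeS /sblocks; lia.
by rewrite (nth_map 0) ?size_iota // nth_iota // add0n subnKC.
Qed.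

Lemma srank_new N x : ssize N <= x < ssize N.+1 -> srank x = N.+1.
Proof.
elim: N x => [|N IHN] x xP; rewrite /srank /row_rank (nth_new xP) //.
rewrite -[LHS]/((top_rank (stage N.+1)).+1).
congr _.+1; rewrite /top_rank row_rank_stage -/(ssize N.+1).
  by apply: IHN; have := sblocks_gt0 N; rewrite ssizeS; lia.
by have := ssize_gt N.+1; lia.
Qed.

Lemma label_stage x : x = 0 \/ exists N, ssize N <= x < ssize N.+1.
Proof.
have [->|x_gt0] := posnP x; [by left | right].
elim: x {-2}x (ssize_gt x) x_gt0 => [|N IHN] x ltx x_gt0.
  by move: ltx; rewrite ltnS leqNgt x_gt0.
have [ltxN|leNx] := ltnP x (ssize N); first exact: IHN.
by exists N; rewrite leNx.
Qed.

Lemma srank0 : srank 0 = 0. Proof. by []. Qed.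

Lemma srank_leq N x : (srank x <= N) = (x < ssize N).
Proof.
case: (label_stage x) => [->|[M xP]].
  by rewrite srank0 leq0n (leq_ltn_trans _ (ssize_gt N)).
rewrite (srank_new xP); case/andP: xP => leMx ltx.
apply/idP/idP => [/leq_ssize|]; first exact: leq_trans.
move=> ltxN; rewrite ltnNge; apply/negP => /leq_ssize; lia.
Qed.

Lemma srank_eq0 x : (srank x == 0) = (x == 0).
Proof. by rewrite -leqn0 srank_leq ltnS leqn0. Qed.

Lemma srankS N x : srank x = N.+1 -> ssize N <= x < ssize N.+1.
Proof. by move=> xN; rewrite -srank_leq xN leqnn leqNgt -srank_leq xN ltnn. Qed.

Lemma top_rank_stage N : top_rank (stage N) = N.
Proof.
have ltN := ssize_gt N; rewrite /top_rank row_rank_stage -/(ssize N); last lia.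
case: N ltN => // N ltN; apply: srank_new; have := sblocks_gt0 N.
by rewrite ssizeS; lia.
Qed.

Lemma mem_slevel N x : (x \in slevel N) = (srank x == N).
Proof.
rewrite mem_filter mem_iota /= add0n -srank_leq.
by case: eqP => // ->; rewrite leqnn.
Qed.

Lemma mem_slower N x : (x \in slower N) = ((srank x).+1 == N).
Proof.
rewrite mem_filter mem_iota /= add0n -srank_leq.
by case: eqP => // <-; rewrite leqnSn.
Qed.

Lemma mem_supers N w y : (y \in supers N w) = (y \in slevel N) && sle w y.
Proof. by rewrite mem_filter andbC. Qed.

Lemma slevel_uniq N : uniq (slevel N).
Proof. exact/filter_uniq/iota_uniq. Qed.

Lemma slower_uniq N : uniq (slower N).
Proof. exact/filter_uniq/iota_uniq. Qed.

Lemma slowerS N : slower N.+1 = slevel N.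
Proof.
apply: (irr_sorted_eq ltn_trans ltnn);
  try exact/(sorted_filter ltn_trans)/iota_ltn_sorted.
by move=> x; rewrite mem_slower mem_slevel.
Qed.

Lemma top_level_stage N : top_level (stage N) = slevel N.
Proof.
apply: eq_in_filter => x; rewrite mem_iota /= => ltx.
by rewrite row_rank_stage // top_rank_stage.
Qed.

Lemma sub_level_stage N : sub_level (stage N) = slower N.
Proof.
apply: eq_in_filter => x; rewrite mem_iota /= => ltx.
by rewrite row_rank_stage // top_rank_stage.
Qed.

Lemma uppers_stage N w : uppers (stage N) w = supers N w.
Proof.
rewrite /uppers top_level_stage; apply: eq_in_filter => y.
by rewrite mem_slevel => /eqP yN; rewrite row_le_stage // -srank_leq yN.
Qed.

Definition ssplits N := needs_split (stage N).

Definition swagner N : seq (seq nat) :=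
  [seq supers N w | w <- slower N] ++ [seq [:: y] | y <- slevel N].
Definition ssplit N z : seq (seq nat) :=
  pairs (supers N z) ++
  [seq supers N w | w : nat <- slower N & w != z] ++
  [seq [:: y] | y : nat <- slevel N & y \notin supers N z].

Lemma wagner_stage N : wagner_blocks (stage N) = swagner N.
Proof.
rewrite /wagner_blocks top_level_stage sub_level_stage.
by congr (_ ++ _); apply: eq_map => w; apply: uppers_stage.
Qed.

Lemma split_stage N z : split_blocks (stage N) z = ssplit N z.
Proof.
rewrite /split_blocks top_level_stage sub_level_stage uppers_stage.
by congr (_ ++ (_ ++ _)); apply: eq_map => w; apply: uppers_stage.
Qed.

Variant sblocks_spec N : seq (seq nat) -> bool -> Type :=
  | SblocksWagner of ~~ ssplits N : sblocks_spec N (swagner N) false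
  | SblocksSplit z a b c of ssplits N & z \in slower N
      & supers N z = [:: a; b; c] : sblocks_spec N (ssplit N z) true.

Lemma sblocksP N : sblocks_spec N (sblocks N) (ssplits N).
Proof.
rewrite /sblocks /new_blocks -/(ssplits N); have [sp|] := boolP (ssplits N); last first.
  by rewrite wagner_stage; constructor.
rewrite split_stage.
have: head 0 (triads (stage N)) \in triads (stage N).
  case/andP: sp => _; case: (triads _) => //= *; exact: mem_head.
rewrite mem_filter sub_level_stage uppers_stage; set z := head _ _.
case/andP=> /eqP sz zN.
move: sz; case E: (supers N z) => [|a [|b [|c []]]] // _.
exact: (SblocksSplit sp zN E).
Qed.

(** Only the three-element block and three singletons are affected when a
    block is split, whatever is being counted. *)
Lemma count_ssplit N z a b c (p : pred (seq nat)) :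
  z \in slower N -> supers N z = [:: a; b; c] ->
  count p (ssplit N z) + (p [:: a; b; c] + p [:: a] + p [:: b] + p [:: c]) =
  count p (swagner N) + (p [:: a; b] + p [:: a; c] + p [:: b; c]).
Proof.
move=> zN Ez; rewrite /ssplit /swagner !count_cat Ez.
have /permP -> : perm_eq [seq supers N w | w <- slower N]
    [seq supers N w | w <- z :: [seq w <- slower N | w != z]].
  by apply: perm_map; rewrite -rem_filter ?slower_uniq ?perm_to_rem.
have /permP -> : perm_eq [seq [:: y] | y <- slevel N]
    [seq [:: y] | y <- [:: a; b; c] ++ [seq y <- slevel N | y \notin [:: a; b; c]]].
  apply: perm_map; rewrite perm_sym -Ez.
  have -> : [seq y <- slevel N | y \notin supers N z] =
      [seq y <- slevel N | ~~ sle z y].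
    by apply: eq_in_filter => y yN; rewrite mem_filter yN andbT.
  exact/permPl/(perm_filterC (sle z)).
rewrite map_cat count_cat /= Ez; lia.
Qed.

(** * The order *)

Lemma sblocks_sub N B : B \in sblocks N -> {subset B <= slevel N}.
Proof.
have sub w : {subset supers N w <= slevel N} by move=> y; rewrite mem_filter => /andP[].
case: sblocksP => [_|z a b c _ zN Ez].
  rewrite mem_cat => /orP[] /mapP[y yN ->]; first exact: sub.
  by move=> x; rewrite inE => /eqP ->.
rewrite !mem_cat => /or3P[].
- move=> Bz y yB; apply: (sub z); move: Bz yB; rewrite Ez /pairs /= !inE.
  by case/or3P=> /eqP -> /=; rewrite !inE => /orP[] ->; rewrite ?orbT.
- by case/mapP=> w _ ->; apply: sub.
- case/mapP=> y; rewrite mem_filter => /andP[_ yN] -> x.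
  by rewrite inE => /eqP ->.
Qed.

(** The number of blocks that contain a given element: this is (D3), with
    [sblocks N] in place of the rank [N.+1] that it gives rise to. *)
Lemma count_sblocks_mem N x : x \in slevel N ->
  count (fun B => x \in B) (sblocks N) = (count (fun w => sle w x) (slower N)).+1.
Proof.
move=> xN.
have W : count (fun B : seq nat => x \in B) (swagner N) =
    (count (fun w => sle w x) (slower N)).+1.
  rewrite count_cat !count_map -addn1; congr (_ + _).
    by apply: eq_count => w /=; rewrite mem_filter xN andbT.
  have -> : 1 = count_mem x (slevel N) by rewrite count_uniq_mem ?slevel_uniq ?xN.
  by apply: eq_count => y /=; rewrite inE eq_sym.
case: sblocksP => // z a b c _ zN Ez; rewrite -W.
move: (ssplit N z) (count_ssplit (fun B => x \in B) zN Ez) => bs.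
rewrite !inE => Ec.
have := slevel_uniq N; move/(filter_uniq (sle z)); rewrite -/(supers N z) Ez /= !inE.
rewrite negb_or => /andP[/andP[ab ac] /andP[bc _]].
have once v w : v != w -> ~~ ((x == v) && (x == w)).
  by apply: contra => /andP[/eqP <- /eqP <-].
move: (once _ _ ab) (once _ _ ac) (once _ _ bc).
move: Ec.
by case: (x == a); case: (x == b); case: (x == c) => //= Ec _ _ _; exact: addIn Ec.
Qed.

(** Likewise (D2) holds for [sblocks N]. *)
Lemma count_sblocks_mem2 N x y : x \in slevel N -> y \in slevel N -> x != y ->
  count (fun B => (x \in B) && (y \in B)) (sblocks N) =
  count (fun w => sle w x && sle w y) (slower N).
Proof.
move=> xN yN xy.
have W : count (fun B : seq nat => (x \in B) && (y \in B)) (swagner N) =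
    count (fun w => sle w x && sle w y) (slower N).
  rewrite count_cat !count_map -[RHS]addn0; congr (_ + _).
    by apply: eq_count => w /=; rewrite !mem_supers xN yN.
  apply/eqP; rewrite eqn0Ngt -has_count; apply/hasPn => u _ /=.
  by rewrite !inE; apply: contra xy => /andP[/eqP-> /eqP->].
case: sblocksP => // z a b c _ zN Ez; rewrite -W.
move: (ssplit N z) (count_ssplit (fun B => (x \in B) && (y \in B)) zN Ez) => bs.
rewrite !inE => Ec.
have := slevel_uniq N; move/(filter_uniq (sle z)); rewrite -/(supers N z) Ez /= !inE.
rewrite negb_or => /andP[/andP[ab ac] /andP[bc _]].
have once u v w : v != w -> ~~ ((u == v) && (u == w)).
  by apply: contra => /andP[/eqP <- /eqP <-].
have xy1 v : ~~ ((x == v) && (y == v)).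
  by apply: contra xy => /andP[/eqP -> /eqP ->].
move: (once y _ _ ab) (once y _ _ ac) (once y _ _ bc).
move: (once x _ _ ab) (once x _ _ ac) (once x _ _ bc) (xy1 a) (xy1 b) (xy1 c).
move: Ec.
by case: (x == a); case: (x == b); case: (x == c); case: (y == a); case: (y == b);
  case: (y == c) => //= Ec *; exact: addIn Ec.
Qed.

Lemma sblock_mem N x : srank x = N.+1 -> sblock x \in sblocks N.
Proof.
move=> xN; rewrite /sblock xN /= mem_nth //.
by case/andP: (srankS xN) => leNx; rewrite ssizeS ltn_subLR.
Qed.

(** The order above a new element is generated by its block. The bound on [y]
    is dropped in [sleE] once ranks are known to increase. *)
Lemma sle_new N x y : srank x = N.+1 ->
  sle y x = (y == x) || (y < ssize N) && has (sle y) (sblock x).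
Proof.
move=> xN; rewrite /sle /row_le (nth_new (srankS xN)) /= mem_cat inE orbC.
rewrite mem_filter mem_iota /= add0n andbC; congr (_ || (_ && _)).
rewrite /sblock xN /=; apply: eq_in_has => w.
have := sblocks_sub (sblock_mem xN); rewrite /sblock xN /= => sub /sub.
by rewrite mem_slevel => /eqP wN; rewrite row_le_stage // -srank_leq wN.
Qed.

Lemma sle_refl : reflexive sle.
Proof.
move=> x; case: (label_stage x) => [->//|[N /srank_new xN]].
by rewrite (sle_new _ xN) eqxx.
Qed.

Lemma sle_srank y x : sle y x -> y = x \/ srank y < srank x.
Proof.
case: (label_stage x) => [->|[N /srank_new xN]].
  by rewrite /sle /row_le /= inE => /eqP ->; left.
rewrite (sle_new _ xN) => /orP[/eqP->|/andP[lty _]]; first by left.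
by right; rewrite xN ltnS srank_leq.
Qed.

Lemma sle_rank y x : sle y x -> srank y <= srank x.
Proof. by case/sle_srank=> [->//|/ltnW]. Qed.

Lemma sleE N x y : srank x = N.+1 -> sle y x = (y == x) || has (sle y) (sblock x).
Proof.
move=> xN; rewrite (sle_new y xN); congr (_ || _).
apply: andb_idl => /hasP[w /(sblocks_sub (sblock_mem xN))].
by rewrite mem_slevel -srank_leq => /eqP <- /sle_rank.
Qed.

Lemma sle_anti : antisymmetric sle.
Proof.
move=> x y /andP[/sle_srank[->//|ltxy] /sle_srank[->//|ltyx]].
by move: (ltn_trans ltxy ltyx); rewrite ltnn.
Qed.

Lemma sle_trans : transitive sle.
Proof.
move=> y x z xy.
elim/ltn_ind: (srank z) {-2}z (erefl (srank z)) => n IHn {}z zn.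
case: (label_stage z) => [->|[N /srank_new zN]].
  by rewrite {1}/sle /row_le /= inE => /eqP yz; rewrite yz in xy.
rewrite !(sleE _ zN) => /orP[/eqP yz|/hasP[w wz yw]].
  by rewrite -(sleE _ zN) -yz.
apply/orP; right; apply/hasP; exists w => //.
have := sblocks_sub (sblock_mem zN) wz; rewrite mem_slevel => /eqP wN.
by apply: (IHn (srank w)) yw; rewrite // wN -zn zN.
Qed.

Lemma mem_sblock N x w : srank x = N.+1 -> srank w = N -> sle w x = (w \in sblock x).
Proof.
move=> xN wN; rewrite (sleE _ xN).
have /negPf -> : w != x by apply: contra_eqN wN => /eqP ->; rewrite xN; lia.
apply/hasP/idP => [[v vx /sle_srank[->//|]]|wx]; last by exists w; rewrite ?sle_refl.
have := sblocks_sub (sblock_mem xN) vx; rewrite mem_slevel => /eqP ->.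
by rewrite wN ltnn.
Qed.

Lemma slevelE N : slevel N.+1 = iota (ssize N) (size (sblocks N)).
Proof.
apply: (irr_sorted_eq ltn_trans ltnn); [|exact: iota_ltn_sorted|].
  exact/(sorted_filter ltn_trans)/iota_ltn_sorted.
move=> x; rewrite mem_slevel mem_iota -ssizeS.
by apply/eqP/idP => [/srankS|/srank_new].
Qed.

Lemma map_sblock N : map sblock (slevel N.+1) = sblocks N.
Proof.
rewrite slevelE; apply: (@eq_from_nth _ [::]); rewrite size_map size_iota // => i lti.
rewrite (nth_map 0) ?size_iota // nth_iota // /sblock (@srank_new N).
  by rewrite addKn.
by rewrite ssizeS; lia.
Qed.

(** The labels of rank [N.+1] are the blocks over rank [N], so the two counts of
    blocks are counts of upper covers. *)
Lemma count_uppers N x : srank x = N ->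
  count (fun u => sle x u) (slevel N.+1) =
  (count (fun w => sle w x) (slower N)).+1.
Proof.
move=> xN; rewrite -count_sblocks_mem ?mem_slevel ?xN // -map_sblock count_map.
apply: eq_in_count => u; rewrite mem_slevel => /eqP uN /=.
exact: mem_sblock uN xN.
Qed.

Lemma count_uppers2 N x y : srank x = N -> srank y = N -> x != y ->
  count (fun u => sle x u && sle y u) (slevel N.+1) =
  count (fun w => sle w x && sle w y) (slower N).
Proof.
move=> xN yN xy.
rewrite -count_sblocks_mem2 ?mem_slevel ?xN ?yN // -map_sblock count_map.
apply: eq_in_count => u; rewrite mem_slevel => /eqP uN /=.
by rewrite !(mem_sblock uN).
Qed.

(** Reflections are nonempty because an element of rank [N.-1] has at least one
    upper cover, by the count at the previous rank. *)
Lemma sblock_neq0 N x : srank x = N.+1 -> exists2 w, w \in sblock x & srank w = N.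
Proof.
move=> xN; suff: sblock x != [::].
  case E: (sblock x) => [//|w B] _; exists w; first by rewrite mem_head.
  by apply/eqP; rewrite -mem_slevel (sblocks_sub (sblock_mem xN)) ?E ?mem_head.
have up w : w \in slower N -> supers N w != [::].
  rewrite mem_slower => /eqP wN; rewrite -size_eq0 size_filter -wN.
  by rewrite count_uppers.
have := sblock_mem xN; case: sblocksP => [_|z a b c _ zN Ez].
  by rewrite mem_cat => /orP[] /mapP[y yN ->] //; apply: up.
rewrite !mem_cat => /or3P[].
- by rewrite !inE => /or3P[] /eqP ->.
- by case/mapP=> w; rewrite mem_filter => /andP[_ wN] ->; apply: up.
- by case/mapP=> w _ ->.
Qed.

Lemma sle0 x : sle 0 x.
Proof.
elim/ltn_ind: (srank x) {-2}x (erefl (srank x)) => n IHn {}x xn.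
case: (label_stage x) => [->//|[N /srank_new xN]].
have [w wx wN] := sblock_neq0 xN.
rewrite (sleE _ xN); apply/orP; right; apply/hasP; exists w => //.
by apply: (IHn (srank w)); rewrite // wN -xn xN.
Qed.

(** Because of this, covering pairs are the comparable pairs of consecutive
    ranks, and the order is graded. *)
Lemma sle_below x y : sle x y -> x != y ->
  exists w, [/\ sle x w, sle w y & (srank w).+1 = srank y].
Proof.
case: (label_stage y) => [->|[N /srank_new yN]].
  by rewrite /sle /row_le /= inE => /eqP ->; rewrite eqxx.
rewrite (sleE _ yN) => /orP[->//|/hasP[w wy xw] _]; exists w.
have := sblocks_sub (sblock_mem yN) wy; rewrite mem_slevel => /eqP wN.
by rewrite (mem_sblock yN) // wN yN.
Qed.

(** * Room for splitting *)

(** The number of lower covers of [x], by [coversP] below. *)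
Definition sdeg x := count (fun w => sle w x) (slower (srank x)).

Lemma sdegE N x : srank x = N.+1 -> sdeg x = count (mem (sblock x)) (slevel N).
Proof.
move=> xN; rewrite /sdeg xN slowerS; apply: eq_in_count => w.
by rewrite mem_slevel => /eqP wN; rewrite (mem_sblock xN wN).
Qed.

Lemma sdeg_singleton N x y : srank x = N.+1 -> srank y = N ->
  sblock x = [:: y] -> sdeg x = 1.
Proof.
move=> xN yN xy; rewrite (sdegE xN) xy (eq_count (mem_seq1 ^~ y)).
by rewrite count_uniq_mem ?slevel_uniq ?mem_slevel ?yN ?eqxx.
Qed.

Lemma size_supers N w : srank w = N -> size (supers N.+1 w) = (sdeg w).+1.
Proof. by move=> wN; rewrite size_filter count_uppers // /sdeg wN. Qed.

Lemma sblocks_sblock N B : B \in sblocks N ->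
  exists2 x, srank x = N.+1 & sblock x = B.
Proof.
by rewrite -map_sblock => /mapP[x xN ->]; exists x => //; apply/eqP; rewrite -mem_slevel.
Qed.

(** The chain of iterated singletons survives all splits, since the elements
    that are split have two lower covers. *)
Lemma sdeg1_exists N : exists x y,
  [/\ srank x = N.+1, srank y = N, sblock x = [:: y] & sdeg y <= 1].
Proof.
elim: N => [|N [x [y [xN yN xy degy]]]]; first by exists 1, 0.
have degx := sdeg_singleton xN yN xy.
suff /sblocks_sblock[u uN ux] : [:: x] \in sblocks N.+1.
  by exists u, x; rewrite degx.
have xl : x \in slevel N.+1 by rewrite mem_slevel xN.
case: sblocksP => [_|z a b c _ zN Ez].
  by rewrite mem_cat (map_f (fun y => [:: y])) ?orbT.
rewrite !mem_cat (map_f (fun y => [:: y])) ?orbT // mem_filter xl andbT.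
have zr : srank z = N by move: zN; rewrite mem_slower => /eqP[].
have degz : sdeg z = 2 by apply: succn_inj; rewrite -(size_supers zr) Ez.
rewrite mem_filter (mem_sblock xN zr) xy inE negb_and; apply/orP; left.
by apply: contraTN degy => /eqP <-; rewrite degz.
Qed.

(** The reflection of an element with one lower cover has two; it is not split,
    as only elements with three upper covers are. *)
Lemma sdeg2_exists N : exists2 x, srank x = N.+3 & sdeg x = 2.
Proof.
have [x [y [xN yN xy _]]] := sdeg1_exists N.
have degx := sdeg_singleton xN yN xy.
suff /sblocks_sblock[u uN ux] : supers N.+2 x \in sblocks N.+2.
  exists u => //; rewrite (sdegE uN) ux -[2]/(1.+1) -degx -(size_supers xN).
  by rewrite size_filter; apply: eq_in_count => y' yl; rewrite /= mem_supers yl.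
have xl : x \in slower N.+2 by rewrite mem_slower xN.
case: sblocksP => [_|z a b c _ zN Ez]; first by rewrite mem_cat map_f.
rewrite !mem_cat map_f ?orbT // mem_filter xl andbT.
apply: contra_eqN degx => /eqP xz; rewrite xz in xN *.
suff -> : sdeg z = 2 by [].
by apply: succn_inj; rewrite -(size_supers xN) Ez.
Qed.

Lemma triads_stage N : 4 <= N -> 0 < size (triads (stage N)).
Proof.
case: N => [|[|[|[|N]]]] // _; have [x xN degx] := sdeg2_exists N.
suff : x \in triads (stage N.+4) by case: (triads _).
by rewrite mem_filter sub_level_stage uppers_stage mem_slower xN (size_supers xN) degx !eqxx.
Qed.

End Labels.

(** * Parity of the number of pairs *)

Section Parity.

Implicit Types (N M n x y : nat).

Definition pair_weight n x y : nat :=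
  (sle x y && (srank x + srank y == n)) +
  ((srank x + srank y <= n) && is_cube (n - (srank x + srank y))).

Lemma weight_stage N n : weight (stage N) n =
  \sum_(0 <= x < ssize N) \sum_(0 <= y < ssize N) pair_weight n x y.
Proof.
rewrite /weight sumnE big_map /index_iota subn0.
apply: eq_big_seq => x; rewrite mem_iota /= => ltx.
rewrite sumnE big_map; apply: eq_big_seq => y; rewrite mem_iota /= => lty.
by rewrite !row_rank_stage // row_le_stage.
Qed.

Lemma pair_weight_eq0 n x y : n < srank x + srank y -> pair_weight n x y = 0.
Proof.
move=> ltn_xy; rewrite /pair_weight leqNgt ltn_xy addn0.
by rewrite (gtn_eqF ltn_xy) andbF.
Qed.

(** Among the pairs that involve an element of the new rank [N.+1], only those
    with the least element have total rank at most [N.+1]. *)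
Lemma weight_new N :
  weight (stage N.+1) N.+1 = weight (stage N) N.+1 + 3 * size (sblocks N).
Proof.
rewrite !weight_stage; have les := leq_ssize (leqnSn N).
have new y : ssize N <= y < ssize N.+1 -> srank y = N.+1 by apply: srank_new.
rewrite (@big_cat_nat _ _ _ (ssize N)) //=.
have -> : \sum_(ssize N <= x < ssize N.+1) \sum_(0 <= y < ssize N.+1)
    pair_weight N.+1 x y = size (sblocks N).
  rewrite -[RHS]muln1 -[size _](addKn (ssize N)) -ssizeS -sum_nat_const_nat.
  apply: eq_big_nat => x xN; rewrite big_ltn ?(leq_ltn_trans _ (ssize_gt _)) //.
  rewrite big_nat big1 ?addn0 => [|y /andP[y_gt0 _]].
    rewrite /pair_weight (new _ xN) srank0 addn0 leqnn subnn /=.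
    suff -> : sle x 0 = false by [].
    by apply/negP => /sle_rank; rewrite (new _ xN).
  by apply: pair_weight_eq0; rewrite (new _ xN); move: y_gt0; rewrite lt0n -srank_eq0; lia.
rewrite mulSn [_ + 2 * _]addnC addnA; congr (_ + _).
under eq_bigr do rewrite (@big_cat_nat _ _ _ (ssize N)) //=.
rewrite big_split /=; congr (_ + _).
rewrite big_ltn ?(leq_ltn_trans _ (ssize_gt _)) //.
rewrite [X in _ + X]big_nat [X in _ + X]big1 ?addn0 => [|x /andP[x_gt0 _]].
  rewrite mulnC -[size _](addKn (ssize N)) -ssizeS -sum_nat_const_nat.
  apply: eq_big_nat => y yN.
  by rewrite /pair_weight (new _ yN) srank0 add0n sle0 leqnn subnn eqxx.
rewrite big_nat big1 // => y yN; apply: pair_weight_eq0; rewrite (new _ yN).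
by move: x_gt0; rewrite lt0n -srank_eq0; lia.
Qed.

(** Below rank 5 no block is split and the parities are checked by computation;
    above, the split corrects the parity whenever this is needed. *)
Lemma weight_even n : ~~ odd (weight (stage n) n).
Proof.
have [lt5|] := ltnP n 5.
  have /allP : all (fun n => ~~ odd (weight (stage n) n)) (iota 0 5) by vm_compute.
  by apply; rewrite mem_iota.
case: n => // N leN; rewrite weight_new oddD oddM /=.
have sw : (size (swagner N) = size (sblocks N) + ssplits N).
  case: sblocksP => [_|z a b c _ zN Ez]; first by rewrite addn0.
  by have := count_ssplit predT zN Ez; rewrite !count_predT /=; lia.
have : ssplits N = odd (weight (stage N) N.+1 + size (swagner N)).
  by rewrite /ssplits /needs_split triads_stage // andbT top_rank_stage wagner_stage.
by rewrite sw oddD oddD; case: (ssplits N); case: odd; case: odd.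
Qed.

End Parity.

(** * The poset is 1-differential and recursively specified *)

(** A copy of [nat], which carries its own order already. *)
Definition label : Type := nat.

Fact label_display : Order.disp_t. Proof. exact: (Order.Disp tt tt). Qed.

HB.instance Definition _ := Choice.on label.
HB.instance Definition _ := @Order.Le_isPOrder.Build label_display label
  sle sle_refl sle_anti sle_trans.
HB.instance Definition _ := @Order.hasBottom.Build label_display label 0 sle0.

Section Differential.

Local Open Scope classical_set_scope.
Local Open Scope card_scope.

Implicit Types x y z : label.

Definition lrank (x : label) : nat := srank x.

Lemma set_seqE (T : choiceType) (s : seq T) : [set` s] = [set` [fset x in s]%fset].
Proof. by apply/seteqP; split=> x /=; rewrite !inE. Qed.

Lemma card_set_seq (T : choiceType) (s : seq T) : uniq s -> [set` s] #= `I_(size s).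
Proof.
move=> us; rewrite set_seqE; apply/card_eq_fsetP.
by rewrite card_fseq undup_id.
Qed.

Lemma card_fset_set_seq (T : choiceType) (s : seq T) :
  uniq s -> #|` fset_set [set` s]| = size s.
Proof. by move=> us; rewrite set_seqE set_fsetK card_fseq undup_id. Qed.

Lemma label_ltE x y : (x < y)%O = (x != y) && sle x y.
Proof. by rewrite Order.POrderTheory.lt_neqAle. Qed.

Lemma coversP x y : covers x y <-> sle x y /\ (srank x).+1 = srank y.
Proof.
split=> [[ltxy nobetween]|[lexy rxy]].
  move: ltxy; rewrite label_ltE => /andP[neq_xy lexy]; split=> //.
  have [w [lexw lewy rwy]] := sle_below lexy neq_xy.
  have [->//|neq_xw] := eqVneq x w.
  have neq_wy : w != y by apply/eqP => wy; move: rwy; rewrite wy; lia.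
  by have := nobetween w; rewrite !label_ltE neq_xw lexw lewy neq_wy.
split=> [|z].
  rewrite label_ltE lexy andbT; apply/eqP => xy; move: rxy; rewrite xy; lia.
rewrite !label_ltE; apply/negP => /andP[/andP[/eqP nxz /sle_srank[//|ltxz]]].
by move=> /andP[/eqP nzy /sle_srank[//|]]; rewrite -rxy; lia.
Qed.

Lemma lower_coversE x : lower_covers x =
  [set` [seq w <- slower (srank x) | sle w x]].
Proof.
apply/seteqP; split=> w /=; rewrite mem_filter mem_slower.
  by case/coversP=> -> ->; rewrite eqxx.
by case/andP=> wx /eqP rw; apply/coversP.
Qed.

Lemma upper_coversE x : upper_covers x =
  [set` [seq u <- slevel (srank x).+1 | sle x u]].
Proof.
apply/seteqP; split=> u /=; rewrite mem_filter mem_slevel.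
  by case/coversP=> -> ->; rewrite eqxx.
by case/andP=> xu /eqP ru; apply/coversP.
Qed.

Lemma label_differential : differential 1 lrank.
Proof.
split.
- move=> x y; apply: (@sub_finite_set _ _ [set` iota 0 (ssize (srank y))]).
    move=> z /= /andP[_ zy]; rewrite mem_iota /= -srank_leq; exact: sle_rank zy.
  exact: finite_seq.
- by split=> // x y /coversP[_ rxy]; rewrite /lrank rxy.
- move=> x y /eqP neq_xy; have [rxy|neq_r] := eqVneq (srank x) (srank y); last first.
    rewrite (_ : _ `&` _ = set0); last first.
      apply/seteqP; split=> // u [/coversP[_ ux] /coversP[_ uy]].
      by case/eqP: neq_r; apply: succn_inj; rewrite ux uy.
    rewrite (_ : _ `&` _ = set0) //.
    apply/seteqP; split=> // u [/coversP[_ ux] /coversP[_ uy]].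
    by case/eqP: neq_r; rewrite -ux -uy.
  have IE (T : choiceType) (s : seq T) (p q : pred T) :
      [set` [seq u <- s | p u]] `&` [set` [seq u <- s | q u]] =
      [set` [seq u <- s | p u && q u]].
    apply/seteqP; split=> u /=; rewrite !mem_filter.
      by case=> /andP[-> ->] /andP[->].
    by case/andP=> /andP[-> ->] ->.
  rewrite !lower_coversE !upper_coversE -rxy !IE.
  have := card_set_seq (filter_uniq (fun u => sle x u && sle y u)
    (slevel_uniq (srank x).+1)).
  rewrite size_filter (count_uppers2 erefl (esym rxy) neq_xy) -size_filter => cu.
  apply: card_eq_trans cu _; rewrite card_eq_sym.
  exact/card_set_seq/filter_uniq/slower_uniq.
- move=> x n; rewrite lower_coversE upper_coversE => lown.
  have := card_set_seq (filter_uniq (fun w => sle w x) (slower_uniq (srank x))).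
  rewrite card_eq_sym => /card_eq_trans/(_ lown)/card_eq_II.
  rewrite size_filter => <-; rewrite addn1 -(count_uppers erefl) -size_filter.
  exact/card_set_seq/filter_uniq/slevel_uniq.
Qed.

Lemma code_enc (L : seq (seq nat)) : CodeSeq.code (map CodeSeq.code L) = enc L.
Proof. by elim: L => //= row L ->. Qed.

(** The rows list the labels below in increasing order, as [prefix_code] does. *)
Lemma stage_row N x : srank x <= N ->
  nth [::] (stage x) x = srank x :: [seq y <- iota 0 (ssize N) | sle y x].
Proof.
move=> rxN; set row := nth _ _ _.
have rowE : row = srank x :: behead row.
  rewrite /srank /row_rank -/row.
  case: (label_stage x) => [x0|[M xM]]; first by rewrite /row x0.
  by rewrite /row (nth_new xM).
rewrite {1}rowE; congr (_ :: _).
apply: (irr_sorted_eq ltn_trans ltnn); last first.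
- move=> y; rewrite mem_filter mem_iota /= add0n -srank_leq andb_idr //.
  by move=> /sle_rank ryx; apply: leq_trans ryx rxN.
- exact/(sorted_filter ltn_trans)/iota_ltn_sorted.
case: (label_stage x) => [x0|[M xM]]; first by rewrite /row x0.
rewrite /row (nth_new xM) /= cats1 (sorted_pairwise ltn_trans) pairwise_rcons.
rewrite -(sorted_pairwise ltn_trans) (sorted_filter ltn_trans) ?iota_ltn_sorted //.
rewrite andbT; apply/allP => y; rewrite mem_filter mem_iota => /andP[_ /= lty].
by case/andP: xM => leMx _; apply: leq_trans leMx.
Qed.

Lemma prefix_code_stage N :
  prefix_code lrank (id : nat -> label) (ssize N) = enc (stage N).
Proof.
rewrite -code_enc; congr CodeSeq.code.
apply: (@eq_from_nth _ 0); rewrite size_map size_iota ?size_map // => x ltx.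
rewrite (nth_map 0) ?size_iota // nth_iota // add0n (nth_map [::]) //.
by rewrite nth_stage_self // (@stage_row N) ?srank_leq.
Qed.

Lemma label_recursively_specified : recursively_specified lrank.
Proof.
have [step [cstep stepE]] := eff_next_stage.
exists id, ssize, step; split=> [|N x||N _].
- by exists id.
- exact: srank_leq.
- exact: cstep.
- by rewrite !prefix_code_stage stepE.
Qed.

End Differential.

(** * Algebra of power series *)

Section PowerSeriesAlgebra.

Import GRing.Theory.
Local Open Scope ring_scope.

Section Ring.
Context {R : comNzRingType}.
Implicit Types (f g h : fps R) (n N : nat).

(** Coefficients below [N] are computed on the truncations at order [N], which
    are polynomials. *)
Definition fps_trunc N f : {poly R} := \poly_(i < N) f i.

Lemma coefM_eq N (p p' q q' : {poly R}) n : (n < N)%N ->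
  (forall i, (i < N)%N -> p`_i = p'`_i) -> (forall i, (i < N)%N -> q`_i = q'`_i) ->
  (p * q)`_n = (p' * q')`_n.
Proof.
move=> ltnN Ep Eq; rewrite !coefM; apply: eq_bigr => i _.
by rewrite Ep ?Eq //; have := ltn_ord i; lia.
Qed.

Lemma coef_trunc N f n : (n < N)%N -> (fps_trunc N f)`_n = f n.
Proof. by move=> ltnN; rewrite coef_poly ltnN. Qed.

Lemma fps_mul_trunc N f g n : (n < N)%N ->
  fps_mul f g n = (fps_trunc N f * fps_trunc N g)`_n.
Proof.
move=> ltnN; rewrite coefM; apply: eq_bigr => i _.
by rewrite !coef_trunc //; have := ltn_ord i; lia.
Qed.

Lemma fps_mulC f g : fps_mul f g = fps_mul g f.
Proof. by apply/funext => n; rewrite !(fps_mul_trunc _ _ (ltnSn n)) mulrC. Qed.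

Lemma fps_mulA f g h : fps_mul f (fps_mul g h) = fps_mul (fps_mul f g) h.
Proof.
apply/funext => n; rewrite !(fps_mul_trunc _ _ (ltnSn n)).
transitivity (fps_trunc n.+1 f * (fps_trunc n.+1 g * fps_trunc n.+1 h))`_n.
  by apply: (coefM_eq (ltnSn n)) => // i ltin; rewrite coef_trunc // (fps_mul_trunc _ _ ltin).
rewrite mulrA.
by apply: (coefM_eq (ltnSn n)) => // i ltin; rewrite coef_trunc // (fps_mul_trunc _ _ ltin).
Qed.

Lemma fps_mul1 f : fps_mul f fps_one = f.
Proof.
apply/funext => n; rewrite /fps_mul big_ord_recr /= big1 => [|i _].
  by rewrite add0r subnn mulr1.
by rewrite /fps_one subn_eq0 leqNgt ltn_ord mulr0.
Qed.

Lemma fps_exp_trunc N f k n : (n < N)%N ->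
  fps_exp f k n = (fps_trunc N f ^+ k)`_n.
Proof.
elim: k n => [|k IHk] n ltnN; first by rewrite expr0 coef1.
rewrite exprS -[fps_exp f k.+1]/(fps_mul f (fps_exp f k)) (fps_mul_trunc _ _ ltnN).
by apply: (coefM_eq ltnN) => // i ltiN; rewrite coef_trunc // IHk.
Qed.

(** Powers of a series without constant term have high order, so the geometric
    series is a finite sum in each degree. *)
Lemma coef_exp_lt (p : {poly R}) k n : p`_0 = 0 -> (n < k)%N -> (p ^+ k)`_n = 0.
Proof.
move=> p0; elim: k n => // k IHk n ltnk; rewrite exprS coefM big1 // => i _.
have [->|i0] := posnP i; first by rewrite p0 mul0r.
by rewrite IHk ?mulr0 //; have := ltn_ord i; lia.
Qed.

Lemma fps_mulV f : f 0%N = 1 -> fps_mul f (fps_inv f) = fps_one.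
Proof.
move=> f0; apply/funext => n; set N := n.+1.
pose U := fps_trunc N (fun i => fps_one i - f i).
have U0 : U`_0 = 0 by rewrite coef_trunc // /fps_one f0 subrr.
rewrite (fps_mul_trunc _ _ (ltnSn n)) -/N.
have -> : (fps_trunc N f * fps_trunc N (fps_inv f))`_n =
    ((1 - U) * \sum_(j < N) U ^+ j)`_n.
  apply: (coefM_eq (ltnSn n)) => i ltiN; rewrite coef_trunc //.
    by rewrite coefB coef1 coef_trunc // subKr.
  rewrite coef_sum /fps_inv (big_ord_widen _ (fun j => fps_exp _ j i) ltiN).
  rewrite big_mkcond /=; apply: eq_bigr => j _; rewrite (fps_exp_trunc _ _ ltiN).
  case: ltnP => // ltij; rewrite coef_exp_lt //.
rewrite -[1 - U]opprB mulNr -subrX1 opprB coefB coef1 coef_exp_lt // subr0 //.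
Qed.

Lemma fps_mulI f g h : f 0%N = 1 -> fps_mul f g = fps_mul f h -> g = h.
Proof.
move=> f0 E; rewrite -[g]fps_mul1 -[h]fps_mul1 -(fps_mulV f0).
by rewrite [fps_mul f _]fps_mulC !fps_mulA -!(fps_mulC (fps_inv f)) -!fps_mulA
  [fps_mul g f]fps_mulC [fps_mul h f]fps_mulC E.
Qed.

Lemma fps_divK f g : g 0%N = 1 -> fps_mul (fps_div f g) g = f.
Proof. by move=> g0; rewrite /fps_div -fps_mulA [fps_mul _ g]fps_mulC fps_mulV ?fps_mul1. Qed.

Lemma fps_exp2 f : fps_exp f 2 = fps_mul f f.
Proof. by rewrite /fps_exp /= fps_mul1. Qed.

End Ring.

Lemma fps_mul_map (R S : comNzRingType) (phi : {rmorphism R -> S}) (f g : fps R) :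
  fps_mul (fun i => phi (f i)) (fun i => phi (g i)) = (fun n => phi (fps_mul f g n)).
Proof.
apply/funext => n; rewrite /fps_mul rmorph_sum; apply: eq_bigr => i _.
by rewrite rmorphM.
Qed.

End PowerSeriesAlgebra.

(** * Irrationality from parities *)

Section Irrationality.

Import GRing.Theory.
Local Open Scope ring_scope.

Lemma is_cubeP n : reflect (exists q, (q * q * q)%N = n) (is_cube n).
Proof.
apply: (iffP hasP) => [[q _ /eqP <-]|[q <-]]; exists q => //.
by rewrite mem_iota /=; nia.
Qed.

(** The cubes next to [k ^ 3] are more than [k] away from it. *)
Lemma is_cube_near k d i j : (d < k)%N -> (i < d)%N -> (j < d)%N ->
  is_cube (k * k * k + i - j)%N = (i == j).
Proof.
move=> ltdk lti ltj; apply/is_cubeP/eqP => [[q Eq]|->]; last first.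
  by exists k; rewrite addnK.
have [ltqk|ltkq|qk] := ltngtP q k; last by move: Eq; rewrite qk; nia.
- have : (q * q * q <= k.-1 * k.-1 * k.-1)%N by rewrite !leq_mul //; lia.
  by case: k ltdk ltqk Eq => // k; rewrite /=; nia.
- have : (k.+1 * k.+1 * k.+1 <= q * q * q)%N by rewrite !leq_mul.
  by nia.
Qed.

Lemma char_zero_intr_eq0 (K : fieldType) (z : int) :
  char_zero K -> (z%:~R == 0 :> K) = (z == 0).
Proof.
move=> /pcharf0P K0; case: z => n; first by rewrite -[_%:~R]/(n%:R) K0.
by rewrite NegzE mulrNz oppr_eq0 -[_%:~R]/(n.+1%:R) K0.
Qed.

(** The parities of the coefficients near a large cube form an identity
    matrix, so that the corresponding Hankel-type determinant is odd: it does
    not vanish in characteristic zero, which no recurrence allows. *)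
Lemma cubes_mod2_irrational (S : fps int) :
  (forall n, (S n)%:~R = (is_cube n)%:R :> 'F_2) ->
  forall K : fieldType, char_zero K ->
    ~ rational_series (fun n => (S n)%:~R : K).
Proof.
move=> S2 K K0 [A [B [B_neq0 BS]]].
pose d := size B; pose k := (d + size A).+1; pose m := (k * k * k)%N.
pose X : 'M[int]_d := \matrix_(i, j) S (m + i - j)%N.
have ltdk : (d < k)%N by rewrite /k; lia.
have lem : (d + size A <= m)%N by rewrite /m; have : (d + size A < k)%N by []; nia.
have detX : \det X != 0.
  have: \det (map_mx intr X : 'M['F_2]_d) = 1.
    rewrite -[RHS](det1 _ d); congr (\det _); apply/matrixP => i j.
    by rewrite !mxE S2 (is_cube_near ltdk).
  rewrite det_map_mx; apply: contra_eqN => /eqP ->; rewrite rmorph0.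
  by rewrite eq_sym oner_eq0.
have XB : (map_mx intr X : 'M[K]_d) *m (\col_(j < d) B`_j) = 0.
  apply/matrixP => i z; rewrite !mxE.
  transitivity (fps_mul (fun i => B`_i) (fun n => (S n)%:~R : K) (m + i)%N).
    rewrite /fps_mul -(big_mkord xpredT (fun j => B`_j * (S (m + i - j)%N)%:~R)).
    have led : (d <= (m + i).+1)%N.
      by rewrite -addnS (leq_trans (leq_addr (size A) d)) // (leq_trans lem) ?leq_addr.
    rewrite (@big_cat_nat _ _ _ d) //=.
    rewrite [X in _ + X]big_nat [X in _ + X]big1 ?addr0 => [|j /andP[ledj _]].
      rewrite big_mkord; apply: eq_bigr => j _.
      by rewrite !mxE mulrC.
    by rewrite nth_default ?mul0r.
  by rewrite BS nth_default // (leq_trans (leq_addl d _)) // (leq_trans lem) ?leq_addr.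
have uX : (map_mx intr X : 'M[K]_d) \in unitmx.
  by rewrite unitmxE det_map_mx unitfE char_zero_intr_eq0.
have B0 : \col_(j < d) B`_j = 0.
  by rewrite -(mulKmx uX (\col_(j < d) B`_j)) XB mulmx0.
case/eqP: B_neq0; apply/polyP => i; rewrite coef0.
have [ltid|] := ltnP i d; last exact: nth_default.
by move/matrixP: B0 => /(_ (Ordinal ltid) 0); rewrite !mxE.
Qed.

End Irrationality.

(** * The series of the poset *)

Section Series.

Import GRing.Theory.
Local Open Scope ring_scope.
Local Open Scope classical_set_scope.

Implicit Types (n x y : nat).

Lemma rank_seriesE N n : (n <= N)%N ->
  rank_series lrank n = \sum_(0 <= x < ssize N) (srank x == n)%:R.
Proof.
move=> lenN; rewrite /rank_series.
have -> : [set x : label | lrank x = n] =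
    [set` [seq x <- iota 0 (ssize N) | srank x == n]].
  apply/seteqP; split=> x /=; rewrite mem_filter mem_iota /= add0n -srank_leq.
    by rewrite /lrank => ->; rewrite eqxx.
  by case/andP=> /eqP.
rewrite card_fset_set_seq ?filter_uniq ?iota_uniq // size_filter.
rewrite -sum1_count big_mkcond /index_iota subn0 -natz natr_sum.
by apply: eq_bigr => x _; case: eqP.
Qed.

Lemma multichain_seriesE N n : (n <= N)%N ->
  multichain_series lrank 2 n =
  \sum_(0 <= x < ssize N) \sum_(0 <= y < ssize N)
    (sle x y && (srank x + srank y == n)%N)%:R.
Proof.
move=> lenN; rewrite /multichain_series.
pose mk (p : nat * nat) : 2.-tuple label := [tuple p.1; p.2].
pose ps := [seq p <- [seq (x, y) | x <- iota 0 (ssize N), y <- iota 0 (ssize N)]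
  | sle p.1 p.2 && (srank p.1 + srank p.2 == n)%N].
have -> : [set t : 2.-tuple label | sorted <=%O t /\ (\sum_(x <- t) lrank x)%N = n] =
    [set` [seq mk p | p <- ps]].
  apply/seteqP; split=> [t|t /mapP[[x y]]] /=.
    case/tupleP: t => x t; case/tupleP: t => y t; rewrite (tuple0 t) /= andbT.
    rewrite !big_cons big_nil addn0 => -[xy rxy].
    apply/mapP; exists (x : nat, y : nat); last exact/val_inj.
    rewrite mem_filter [sle _ _]xy /= -[(_ + _)%N]/(lrank x + lrank y)%N rxy eqxx.
    apply/allpairsP; exists (x : nat, y : nat).
    by rewrite !mem_iota !add0n -!srank_leq -/(lrank x) -/(lrank y); split=> //=; lia.
  rewrite mem_filter /= => /andP[/andP[xy /eqP rxy] _] ->.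
  by rewrite /= andbT !big_cons big_nil addn0.
rewrite card_fset_set_seq; last first.
  rewrite map_inj_uniq ?filter_uniq ?allpairs_uniq ?iota_uniq //.
    by move=> [x y] [x' y'] _ _ [-> ->].
  by move=> [x y] [x' y'] /(congr1 val) [-> ->].
rewrite size_map size_filter -sum1_count big_mkcond big_allpairs.
rewrite /index_iota subn0 -natz natr_sum; apply: eq_bigr => x _.
by rewrite natr_sum; apply: eq_bigr => y _ /=; case: ifP.
Qed.

(** Used twice, this expands T F^2 over the pairs that [weight] counts. *)
Lemma rank_series_mul N n (g : fps int) : (n <= N)%N ->
  fps_mul (rank_series lrank) g n =
  \sum_(0 <= x < ssize N | (srank x <= n)%N) g (n - srank x)%N.
Proof.
move=> lenN; rewrite /fps_mul.
under eq_bigr => i _ do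
  rewrite (@rank_seriesE N) ?(leq_trans _ lenN) -1?ltnS // mulr_suml.
rewrite exchange_big [RHS]big_mkcond; apply: eq_bigr => x _.
case: ifP => [lexn|ltnx].
  rewrite (bigD1 (Ordinal (lexn : (srank x < n.+1)%N))) //= eqxx mul1r.
  rewrite big1 ?addr0 // => i; rewrite -val_eqE /= eq_sym => /negPf ->.
  by rewrite mul0r.
rewrite big1 // => i _; case: eqP => [xi|]; rewrite ?mul0r //.
by move: ltnx; rewrite xi -ltnS ltn_ord.
Qed.

Definition cube_series : fps int := fun n => (is_cube n)%:R.

Lemma weight_series n : (weight (stage n) n)%:R =
  multichain_series lrank 2 n +
  fps_mul (rank_series lrank) (fps_mul (rank_series lrank) cube_series) n.
Proof.
rewrite (multichain_seriesE (leqnn n)) (rank_series_mul _ (leqnn n)).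
rewrite weight_stage [X in _ = _ + X]big_mkcond -big_split natr_sum; apply: eq_bigr => x _ /=.
have -> : (if (srank x <= n)%N then
     fps_mul (rank_series lrank) cube_series (n - srank x)%N else 0) =
   \sum_(0 <= y < ssize n) ((srank x + srank y <= n)%N &&
      is_cube (n - (srank x + srank y))%N)%:R.
  case: leqP => [lexn|ltnx]; last first.
    by rewrite big1 // => y _; case: leqP => //; lia.
  rewrite (rank_series_mul _ (leq_subr _ n)) big_mkcond; apply: eq_bigr => y _.
  by rewrite /cube_series subnDA -leq_subRL //; case: leqP.
rewrite -big_split natr_sum; apply: eq_bigr => y _.
by rewrite /pair_weight natrD.
Qed.

Lemma rank_series0 : rank_series lrank 0 = 1.
Proof.
rewrite (rank_seriesE (leqnn 0)) /ssize /= big_nat1 //.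
Qed.

(** M and T F^2 agree modulo 2, and F^2 cancels as it has constant term 1. *)
Lemma Q_series_mod2 n : (Q_series lrank n)%:~R = (is_cube n)%:R :> 'F_2.
Proof.
pose F := rank_series lrank; pose M := multichain_series lrank 2.
pose phi (f : fps int) : fps 'F_2 := fun n => (f n)%:~R.
have F0 : fps_mul F F 0%N = 1 by rewrite /fps_mul big_ord1 /F rank_series0 mulr1.
have phiM f g : phi (fps_mul f g) = fps_mul (phi f) (phi g).
  by rewrite /phi (fps_mul_map (intr : {rmorphism int -> 'F_2})).
have M2 : phi M = phi (fps_mul F (fps_mul F cube_series)).
  have two0 : 2%:R = 0 :> 'F_2 by apply/val_inj.
  apply/funext => k; set X := fps_mul F _; apply: (addIr (phi X k)).
  rewrite -mulr2n -[RHS]mulr_natr two0 mulr0 /phi -rmorphD /= -weight_series.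
  rewrite rmorph_nat -[weight _ _]odd_double_half (negPf (weight_even k)) add0n.
  by rewrite -mul2n natrM two0 mul0r.
suff: phi (Q_series lrank) = phi cube_series.
  by move/(congr1 (fun f => f n)); rewrite /phi /cube_series rmorph_nat.
apply: (@fps_mulI _ (phi (fps_mul F F))); first by rewrite /phi F0.
by rewrite -!phiM -[fps_mul _ cube_series]fps_mulA -M2 fps_mulC /Q_series fps_exp2 fps_divK.
Qed.

Lemma Q_series_irrational (K : fieldType) : char_zero K ->
  ~ rational_over K (fun n => (Q_series lrank n)%:~R).
Proof.
move=> K0; rewrite /rational_over; under [X in rational_series X]eq_fun do rewrite ratr_int.
exact: cubes_mod2_irrational Q_series_mod2 K K0.
Qed.

End Series.

Theorem theorem1p1 :
  (exists (d : Order.disp_t) (P : bPOrderType d) (rho : P -> nat),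
     [/\ differential 1 rho,
         recursively_specified rho
       & forall K : fieldType, char_zero K ->
           ~ rational_over K (fun n => ((Q_series rho n)%:~R)%R)])
  /\
  ~ (forall (d : Order.disp_t) (P : bPOrderType d) (rho : P -> nat),
       (exists r : nat, (0 < r)%N /\ differential r rho) ->
       forall k : nat, (0 < k)%N ->
       exists K : fieldType, char_zero K /\
       exists R : fps K, rational_series R /\
         forall n : nat,
           ((multichain_series rho k n)%:~R)%R =
             fps_mul R
               (fps_exp (fun i => ((rank_series rho i)%:~R)%R) k) n).
Proof.
split.
  exists label_display, label, lrank; split.
  - exact: label_differential.
  - exact: label_recursively_specified.
  - exact: Q_series_irrational.
move=> stanley.
have r1 : exists r : nat, (0 < r)%N /\ differential r lrank.
  by exists 1; split=> //; apply: label_differential.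
have [K [K0 [R [ratR MR]]]] := stanley _ label lrank r1 2 isT.
apply: (@cubes_mod2_irrational (Q_series lrank) Q_series_mod2 K K0).
have F0 : fps_mul (rank_series lrank) (rank_series lrank) 0%N = 1%R.
  by rewrite /fps_mul big_ord1 rank_series0 GRing.mulr1.
suff <- : R = (fun n => (Q_series lrank n)%:~R)%R by [].
pose F := fps_mul (rank_series lrank) (rank_series lrank).
apply: (@fps_mulI _ (fun n => (F n)%:~R)%R); first by rewrite /F F0.
transitivity (fun n => (multichain_series lrank 2 n)%:~R : K)%R.
  apply/funext => n; rewrite MR fps_exp2 (fps_mul_map (intr : {rmorphism int -> K})).
  by rewrite fps_mulC.
rewrite (fps_mul_map (intr : {rmorphism int -> K})) fps_mulC.
by rewrite /Q_series fps_exp2 fps_divK.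
Qed.
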